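(* Suppose $h\in\mathbb{R}[x_1,\ldots,x_n]$ is hyperbolic with respect to $\mathbf{e}\in\mathbb{R}^n$ and suppose $\mathbf{v}_1,\ldots,\mathbf{v}_m\in\Lambda_+(\mathbf{e})$ are such that $\mathbf{e}=\mathbf{v}_1+\cdots+\mathbf{v}_m$ and $\operatorname{tr}(\mathbf{v}_j)\leq\epsilon$ for each $1\leq j\leq m$. Then the largest zero of the polynomial $t\mapsto h[\mathbf{v}_1,\ldots,\mathbf{v}_m](t\mathbf{e}+\mathbf{1})$ is at most $$\delta(\epsilon,m):=\Big(1-\frac1m+\sqrt{\epsilon-\frac1m\Big(1-\frac1m\Big)}\Big)^2.$$
   Context: A homogeneous polynomial $h$ of degree $d$ is hyperbolic with respect to $\mathbf{e}\in\mathbb{R}^n$ if $h(\mathbf{e})\neq0$ and for every $\mathbf{x}$, $t\mapsto h(t\mathbf{e}-\mathbf{x})$ has only real zeros; writing $h(t\mathbf{e}-\mathbf{x})=h(\mathbf{e})\prod_{j=1}^d(t-\lambda_j(\mathbf{x}))$ defines the eigenvalues. $\Lambda_+(\mathbf{e})=\{\mathbf{x}:\min_j\lambda_j(\mathbf{x})\geq0\}$, $\operatorname{tr}(\mathbf{x})=\sum_j\lambda_j(\mathbf{x})$. $D_{\mathbf{v}}=\sum_kv_k\partial/\partial x_k$, and $h[\mathbf{v}_1,\ldots,\mathbf{v}_m]:=\prod_{j=1}^m(1-y_jD_{\mathbf{v}_j})h(\mathbf{x})\in\mathbb{R}[x_1,\ldots,x_n,y_1,\ldots,y_m]$. Here $t\mathbf{e}+\mathbf{1}$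 denotes the point $(t\mathbf{e},1,\ldots,1)\in\mathbb{R}^n\oplus\mathbb{R}^m$, i.e. $\mathbf{x}=t\mathbf{e}$ and $y_1=\cdots=y_m=1$. *)

(* Defs.v *)
From HB Require Import structures.
From mathcomp Require Import all_boot all_order all_algebra.
From mathcomp Require Import mpoly.
From mathcomp Require Import complex.
Set Implicit Arguments. Unset Strict Implicit. Unset Printing Implicit Defensive.
Import Order.TTheory GRing.Theory Num.Theory.
Local Open Scope ring_scope.

Section Hyperbolic.
Variables (R : rcfType) (n : nat).

Definition restr_poly (h : {mpoly R[n]}) (e x : 'I_n -> R) : {poly R} :=
  mmap (@polyC R) (fun i => e i *: 'X - (x i)%:P) h.

Definition only_real_zeros (p : {poly R}) : Prop :=
  forall z : R[i], root (map_poly (real_complex R) p) z -> complex.Im z = 0.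

Definition hyperbolic (d : nat) (h : {mpoly R[n]}) (e : 'I_n -> R) : Prop :=
  [/\ h \is d.-homog, h.@[e] != 0 & forall x, only_real_zeros (restr_poly h e x)].

Definition eigenvalues (d : nat) (h : {mpoly R[n]}) (e x : 'I_n -> R) (s : seq R) : Prop :=
  size s = d /\ restr_poly h e x = h.@[e] *: \prod_(l <- s) ('X - l%:P).

Definition in_Lambda_plus (d : nat) (h : {mpoly R[n]}) (e x : 'I_n -> R) : Prop :=
  forall s, eigenvalues d h e x s -> forall l, l \in s -> 0 <= l.

Definition trace_le (d : nat) (h : {mpoly R[n]}) (e x : 'I_n -> R) (eps : R) : Prop :=
  forall s, eigenvalues d h e x s -> \sum_(l <- s) l <= eps.

End Hyperbolic.

Section Mixed.
Variables (R : rcfType) (n m : nat).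

(* x-variables are 'X_(lshift m i), y-variables are 'X_(rshift n j) in R[x_1..x_n,y_1..y_m]. *)
Definition lift_x (h : {mpoly R[n]}) : {mpoly R[n + m]} :=
  mmap (fun c => c%:MP) (fun i => 'X_(lshift m i)) h.

Definition Dx (v : 'I_n -> R) (p : {mpoly R[n + m]}) : {mpoly R[n + m]} :=
  \sum_(i < n) v i *: p^`M(lshift m i).

(* h[v_1,...,v_m] = prod_j (1 - y_j D_{v_j}) h *)
Definition mixed (h : {mpoly R[n]}) (v : 'I_m -> 'I_n -> R) : {mpoly R[n + m]} :=
  foldr (fun j p => p - 'X_(rshift n j) * Dx (v j) p) (lift_x h) (enum 'I_m).

Definition eval_te1 (P : {mpoly R[n + m]}) (e : 'I_n -> R) : {poly R} :=
  mmap (@polyC R)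
    (fun k => match split k with inl i => e i *: 'X | inr _ => 1 end) P.

End Mixed.

Definition delta (R : rcfType) (eps : R) (m : nat) : R :=
  (1 - m%:R^-1 + Num.sqrt (eps - m%:R^-1 * (1 - m%:R^-1))) ^+ 2.

(* Main.v *)
Require Import Defs.
From HB Require Import structures.
From mathcomp Require Import all_boot all_order all_algebra.
From mathcomp Require Import mpoly.
From mathcomp Require Import complex.
From mathcomp Require Import ring lra.
Import Order.TTheory GRing.Theory Num.Theory.
Local Open Scope ring_scope.
Set Implicit Arguments. Unset Strict Implicit. Unset Printing Implicit Defensive.

(* For fixed [j], apply the operators [1 - q D_i] for all [i <> j] and then
   [1 - kappa D_j] to [h].  In the barrier argument of Marcus, Spielman and
   Srivastava, a step with weight [q] moves a point lying above the zeros by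
   [delta v_i] without increasing any of the barriers [D_k g / g], while the last
   step needs no move as long as [kappa] times its barrier is below [1].  Hence the
   point with x-part [alpha e + delta sum_(i <> j) v_i] and y-part [kappa] at [j],
   [q] elsewhere, belongs to the hyperbolicity cone of the mixed polynomial.  The
   average over [j] of these points is [t e + 1] as soon as
   [kappa / m + (1 - 1 / m) q = 1], and optimising [kappa] gives the bound.

   The base field being an arbitrary real closed field, limits are avoided.  The
   convexity of the hyperbolicity cone (Garding) is proved by induction on the
   degree: [h / D_e h] has positive imaginary part on a real line in the direction
   [v], and this propagates to the upper half-plane by a finite Poisson formula.
   The barriers are decreasing and convex because [D_v g / g] has a partial fraction
   expansion with nonnegative coefficients, by Gauss-Lucas. *)

(** * Univariate preliminaries *)

Section Lagrange.
Variable F : fieldType.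
Implicit Types (s : seq F) (P : {poly F}) (w : F).

Lemma logderiv_prod s w : (forall r, r \in s -> w != r) ->
  (\prod_(r <- s) ('X - r%:P))^`().[w] / (\prod_(r <- s) ('X - r%:P)).[w]
    = \sum_(r <- s) (w - r)^-1.
Proof.
elim: s => [|r s IH] hs; first by rewrite !big_nil derivC horner0 mul0r.
rewrite !big_cons derivM derivXsubC mul1r hornerD !hornerM hornerXsubC.
have wr : w - r != 0 by rewrite subr_eq0 hs ?mem_head.
have hs' r' : r' \in s -> w != r' by move=> ?; rewrite hs // inE orbC; apply/orP; left.
have Vw : (\prod_(j <- s) ('X - j%:P)).[w] != 0.
  rewrite horner_prod prodf_seq_neq0; apply/allP => r' /hs' /=.
  by rewrite hornerXsubC subr_eq0.
rewrite -(IH hs'); field.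
by rewrite wr Vw.
Qed.

Lemma prodXsubC_divK s r : r \in s ->
  \prod_(x <- s) ('X - x%:P) =
    ('X - r%:P) * (\prod_(x <- s) ('X - x%:P) %/ ('X - r%:P)).
Proof.
move=> rs; rewrite mulrC divpK // dvdp_XsubCl.
by rewrite root_prod_XsubC.
Qed.

Lemma lagrange_prodXsubC s P : uniq s -> (size P <= size s)%N ->
  let V := \prod_(x <- s) ('X - x%:P) in
  P = \sum_(r <- s) (P.[r] / V^`().[r]) *: (V %/ ('X - r%:P)).
Proof.
move=> us sP V; pose W r := V %/ ('X - r%:P).
have VW r : r \in s -> V = ('X - r%:P) * W r by exact: prodXsubC_divK.
have dV r : r \in s -> V^`().[r] = (W r).[r].
  move=> rs; rewrite {1}(VW r rs) derivM derivXsubC mul1r hornerD hornerM hornerXsubC.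
  by rewrite subrr mul0r addr0.
have V0 : V != 0 by rewrite monic_neq0 // monic_prod_XsubC.
have dV0 r : r \in s -> V^`().[r] != 0.
  move=> rs; rewrite dV //.
  suff -> : W r = \prod_(x <- rem r s) ('X - x%:P).
    by rewrite -rootE root_prod_XsubC mem_rem_uniq // !inE eqxx.
  by rewrite /W /V (perm_big _ (perm_to_rem rs)) big_cons mulKp // polyXsubC_eq0.
have Wr r x : r \in s -> x \in s -> x != r -> (W r).[x] = 0.
  move=> rs xs xr; have : root V x by rewrite root_prod_XsubC.
  rewrite (VW r rs) rootM root_XsubC (negPf xr) /= => /rootP //.
apply/eqP; rewrite -subr_eq0; apply/eqP.
apply: (roots_geq_poly_eq0 (rs := s)) => //.
- apply/allP => x xs; apply/rootP.
  rewrite hornerD hornerN horner_sum (bigD1_seq x) //= big_seq_cond big1 => [|r /andP[rs rx]].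
    by rewrite addr0 hornerZ -/V -/(W x) -dV // divfK ?dV0 // subrr.
  by rewrite hornerZ -/V -/(W r) Wr ?mulr0 // eq_sym.
- apply: (leq_trans (size_polyD _ _)); rewrite geq_max sP size_polyN.
  apply: (leq_trans (size_sum _ _ _)).
  elim/big_ind: _ => // [m n hm hn|r _]; first by rewrite geq_max hm hn.
  apply: leq_trans (size_scale_leq _ _) _.
  by rewrite size_divp ?polyXsubC_eq0 // size_XsubC /V size_prod_XsubC subn1.
Qed.

Lemma lagrange_frac s P w : uniq s -> (size P <= size s)%N -> w \notin s ->
  let V := \prod_(x <- s) ('X - x%:P) in
  P.[w] / V.[w] = \sum_(r <- s) P.[r] / V^`().[r] / (w - r).
Proof.
move=> us sP ws V; rewrite {1}(lagrange_prodXsubC us sP) -/V horner_sum mulr_suml.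
have Vw : V.[w] != 0 by move: ws; rewrite -(root_prod_XsubC s w).
rewrite big_seq [RHS]big_seq; apply: eq_bigr => r rs.
have wr : w - r != 0 by rewrite subr_eq0; apply: contraNneq ws => ->.
rewrite hornerZ -mulrA; congr (_ * _).
have: V.[w] = (w - r) * (V %/ ('X - r%:P)).[w].
  by rewrite {1}/V (prodXsubC_divK rs) hornerM hornerXsubC.
move=> E; rewrite E in Vw *; move: Vw; rewrite mulf_eq0 negb_or => /andP[_ h].
by field; rewrite wr h.
Qed.
Lemma uniq_deriv_prodXsubC s :
  (forall x, x \in s -> (\prod_(r <- s) ('X - r%:P))^`().[x] != 0) -> uniq s.
Proof.
elim: s => // a s IH hs /=; apply/andP; split.
  apply/negP => as_; move/negP: (hs a (mem_head _ _)); apply.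
  rewrite big_cons derivM derivXsubC mul1r hornerD hornerM hornerXsubC subrr mul0r addr0.
  by rewrite -rootE root_prod_XsubC.
apply: IH => x xs; have := hs x; rewrite inE xs orbT => /(_ isT).
rewrite big_cons derivM derivXsubC mul1r hornerD hornerM hornerXsubC.
have /rootP -> : root (\prod_(r <- s) ('X - r%:P)) x by rewrite root_prod_XsubC.
by rewrite add0r mulf_eq0 negb_or => /andP[].
Qed.

End Lagrange.

(** * Complex polynomials without zeros in a half-plane *)

Section HalfPlane.
Variable R : rcfType.
Notation C := (R[i]).
Notation Re := (@complex.Re R).
Notation Im := (@complex.Im R).
Notation "x %:C" := (real_complex R x).
Implicit Types (f A B : {poly C}) (z w : C).

Lemma ImD z w : Im (z + w) = Im z + Im w.
Proof. by case: z w => [a b] [c d]. Qed.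

Lemma ImB z w : Im (z - w) = Im z - Im w.
Proof. by case: z w => [a b] [c d]. Qed.

Lemma Im_sum (I : Type) (s : seq I) (F : I -> C) :
  Im (\sum_(i <- s) F i) = \sum_(i <- s) Im (F i).
Proof. exact: (big_morph _ ImD). Qed.

Lemma ImMr (x : R) z : Im (x%:C * z) = x * Im z.
Proof. by case: z => a b /=; rewrite mul0r addr0. Qed.

Lemma ImCJ z : Im (z^*)%C = - Im z.
Proof. by case: z. Qed.

Lemma real_of_Im0 z : Im z = 0 -> z = (Re z)%:C.
Proof. by case: z => a b /= ->. Qed.

Lemma sqnorm_gt0 z : Im z != 0 -> 0 < Re z ^+ 2 + Im z ^+ 2.
Proof. by move=> h; rewrite ltr_wpDl ?sqr_ge0 // lt_def sqr_ge0 sqrf_eq0 h. Qed.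

Lemma ImV z : Im z^-1 = - Im z / (Re z ^+ 2 + Im z ^+ 2).
Proof. by case: z => a b /=; rewrite mulNr. Qed.

Lemma ImV_lt0 z : 0 < Im z -> Im z^-1 < 0.
Proof.
move=> h; rewrite ImV mulNr oppr_lt0 divr_gt0 // sqnorm_gt0 //.
by rewrite gt_eqF.
Qed.

Lemma ImV_gt0 z : Im z < 0 -> 0 < Im z^-1.
Proof.
move=> h; rewrite ImV divr_gt0 ?oppr_gt0 // sqnorm_gt0 //.
by rewrite lt_eqF.
Qed.

Lemma sumr_lt0 (I : eqType) (s : seq I) (F : I -> R) :
  (0 < size s)%N -> (forall i, i \in s -> F i < 0) -> \sum_(i <- s) F i < 0.
Proof.
case: s => // a s _ h; rewrite big_cons big_seq.
have h1 : \sum_(i <- s | i \in s) F i <= 0.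
  by apply: sumr_le0 => i si; rewrite ltW // h // inE si orbT.
by have := h a (mem_head _ _); lra.
Qed.

(** Gauss-Lucas: [f' / f] at [w] is the sum of the [(w - r)^-1] over the roots [r], all of which lie
    strictly below [w], and inversion maps the upper half-plane to the lower one. The size
    hypothesis provides at least one root. *)
Lemma Im_logderiv_lt0 f w : (forall z, Im w <= Im z -> f.[z] != 0) ->
  (1 < size f)%N -> Im (f^`().[w] / f.[w]) < 0.
Proof.
move=> hf sf; case: (closed_field_poly_normal f) => s fE.
have f0 : f != 0 by rewrite -size_poly_gt0 (leq_trans _ sf).
have lf0 : lead_coef f != 0 by rewrite lead_coef_eq0.
have ss : (0 < size s)%N.
  by move: sf; rewrite fE size_scale // size_prod_XsubC ltnS.
have hs r : r \in s -> Im r < Im w.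
  move=> rs; rewrite ltNge; apply/negP => /hf; rewrite {1}fE hornerZ.
  by rewrite mulf_eq0 negb_or lf0 /= -rootE root_prod_XsubC rs.
rewrite fE derivZ !hornerZ invfM mulrACA divff // mul1r logderiv_prod.
  rewrite Im_sum; apply: sumr_lt0 => // r /hs h.
  by apply: ImV_lt0; rewrite ImB subr_gt0.
by move=> r /hs; apply: contraTneq => ->; rewrite ltxx.
Qed.

Lemma Im_logderiv_le0 f w : (forall z, Im w <= Im z -> f.[z] != 0) ->
  Im (f^`().[w] / f.[w]) <= 0.
Proof.
move=> hf; case: (leqP (size f) 1) => [/size1_polyC -> |sf].
  by rewrite derivC horner0 mul0r.
exact/ltW/Im_logderiv_lt0.
Qed.

Lemma logderiv0_gt0 f : (1 < size f)%N ->
  (forall z, f.[z] = 0 -> exists2 r : R, r < 0 & z = r%:C) ->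
  exists2 c : R, 0 < c & f^`().[0] = c%:C * f.[0].
Proof.
move=> sf hf; case: (closed_field_poly_normal f) => s fE.
have f0 : f != 0 by rewrite -size_poly_gt0 (leq_trans _ sf).
have lf0 : lead_coef f != 0 by rewrite lead_coef_eq0.
have ss : (0 < size s)%N.
  by move: sf; rewrite fE size_scale // size_prod_XsubC ltnS.
have hs r : r \in s -> exists2 c : R, c < 0 & r = c%:C.
  move=> rs; apply: hf; rewrite fE hornerZ; apply/eqP.
  by rewrite mulf_eq0 -rootE root_prod_XsubC rs orbT.
have f00 : f.[0] != 0.
  apply/negP => /eqP /hf [c c0 /complexI E]; by rewrite -E ltxx in c0.
exists (- \sum_(r <- s) (Re r)^-1).
  rewrite oppr_gt0; apply: sumr_lt0 => // r /hs [c c0 -> /=].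
  by rewrite invr_lt0.
have E : f^`().[0] / f.[0] = (- \sum_(r <- s) (Re r)^-1)%:C.
  rewrite fE derivZ !hornerZ invfM mulrACA divff // mul1r logderiv_prod.
    rewrite rmorphN rmorph_sum /= -sumrN big_seq [RHS]big_seq.
    by apply: eq_bigr => r /hs [c c0 ->] /=; rewrite sub0r invrN fmorphV.
  by move=> r /hs [c c0 ->]; apply: contraTneq c0 => /complexI <-; rewrite ltxx.
by rewrite -E divfK.
Qed.

Lemma norm_sub_conj_lt p w : Im p < 0 -> 0 < Im w -> `|w - (p^*)%C| < `|w - p|.
Proof.
case: p w => [a b] [c d] /= hb hd; rewrite !normc_def ltcR /= ltr_sqrt.
  by nra.
by rewrite ltr_wpDl ?sqr_ge0 // exprn_even_gt0 //= gt_eqF // subr_gt0 (lt_trans hb).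
Qed.

(** A point of the upper half-plane is closer to the reflected zeros than to the zeros themselves.
    Hence a polynomial with all zeros in the lower half-plane and its conjugate cannot cancel
    there. *)
Lemma norm_prod_conj_lt (s : seq C) w : (0 < size s)%N ->
  (forall p, p \in s -> Im p < 0) -> 0 < Im w ->
  `|\prod_(p <- s) (w - (p^*)%C)| < `|\prod_(p <- s) (w - p)|.
Proof.
move=> + + hw; elim: s => // a s IH _ hs.
rewrite !big_cons !normrM.
have ha := norm_sub_conj_lt (hs a (mem_head _ _)) hw.
case: s IH hs => [|b s] IH hs; first by rewrite !big_nil normr1 !mulr1.
have h : `|\prod_(p <- b :: s) (w - (p^*)%C)| < `|\prod_(p <- b :: s) (w - p)|.
  by apply: IH => // p ps; apply: hs; rewrite inE ps orbT.
by apply: ltr_pM.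
Qed.

Lemma conj_prodXsubC (s : seq C) z :
  ((\prod_(p <- s) ('X - p%:P)).[z]^*)%C = (\prod_(p <- s) ('X - ((p^*)%C)%:P)).[(z^*)%C].
Proof.
rewrite !horner_prod (rmorph_prod (@conjc R)).
by apply: eq_bigr => p _; rewrite !hornerXsubC rmorphB.
Qed.

Lemma conj_pair_diff (x : R) (p : C) : Im p != 0 ->
  (x%:C - p)^-1 - (x%:C - (p^*)%C)^-1
    = (0 +i* 1)%C * (2 * Im p / ((x - Re p) ^+ 2 + Im p ^+ 2))%:C.
Proof.
case: p => a b /= hb.
have h : (x - a) ^+ 2 + b ^+ 2 != 0.
  by rewrite gt_eqF // ltr_wpDl ?sqr_ge0 // lt_def sqr_ge0 sqrf_eq0 hb.
by apply/eqP; rewrite eq_complex /=; apply/andP; split; apply/eqP; field;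
  move: h; rewrite -?[X in X + _]expr2 // sqrrN.
Qed.

(** The strict norm inequality excludes zeros of [U] in the upper half-plane, and conjugation
    symmetry excludes them in the lower one. At a real zero the conjugate polynomial equals [- E],
    so [U' / E] is a difference of two logarithmic derivatives, a purely imaginary number of known
    sign; since it is nonzero, the zeros are simple. *)
Lemma Hermite_Biehler_nodes (ps : seq C) :
  (0 < size ps)%N -> (forall p, p \in ps -> Im p < 0) ->
  let E := \prod_(p <- ps) ('X - p%:P) in
  let U := E + \prod_(p <- ps) ('X - ((p^*)%C)%:P) in
  exists xs : seq R,
    [/\ uniq xs, size xs = size ps, U = 2 *: \prod_(x <- xs) ('X - x%:C%:P)
      & forall x, x \in xs -> exists2 k : R, k < 0 &
          U^`().[x%:C] = E.[x%:C] * ((0 +i* 1)%C * k%:C)].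
Proof.
move=> s0 hps E U; pose Es : {poly C} := \prod_(p <- ps) ('X - ((p^*)%C)%:P).
have EmE : E \is monic by rewrite monic_prod_XsubC.
have EsM : Es \is monic by rewrite monic_prod_XsubC.
have sE : size E = (size ps).+1 by rewrite size_prod_XsubC.
have sEs : size Es = (size ps).+1.
  by rewrite /Es -(big_map (@conjc R) xpredT (fun p => 'X - p%:P)) size_prod_XsubC size_map.
have lU : U`_(size ps) = 2.
  have := monicP EmE; rewrite lead_coefE sE /= => e1.
  have := monicP EsM; rewrite lead_coefE sEs /= => e2.
  by rewrite coefD e1 e2.
have sU : size U = (size ps).+1.
  apply/eqP; rewrite eqn_leq; apply/andP; split.
    by apply: leq_trans (size_polyD _ _) _; rewrite sE sEs maxnn.
  by apply: contraT; rewrite -leqNgt => /leq_sizeP/(_ _ (leqnn _))/eqP;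
    rewrite lU pnatr_eq0.
have conjU z : (U.[z]^*)%C = U.[(z^*)%C].
  have cE w : (E.[w]^*)%C = Es.[(w^*)%C] by rewrite /E /Es conj_prodXsubC.
  have := cE (z^*)%C; rewrite conjcK => cE'.
  by rewrite /U !hornerD rmorphD /= -/Es cE -cE' conjcK addrC.
have Uup z : 0 < Im z -> U.[z] != 0.
  move=> hz; have := norm_prod_conj_lt s0 hps hz.
  rewrite /U hornerD addr_eq0 !horner_prod.
  under [X in _ -> ~~ (X == _)]eq_bigr do rewrite hornerXsubC.
  under [X in _ -> ~~ (_ == - X)]eq_bigr do rewrite hornerXsubC.
  by apply: contraTneq => ->; rewrite normrN ltxx.
have Ureal z : U.[z] = 0 -> Im z = 0.
  move=> hz; case: (ltgtP (Im z) 0) => // h.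
    have: 0 < Im (z^*)%C by rewrite ImCJ oppr_gt0.
    by move/Uup; rewrite -conjU hz conjc0 eqxx.
  by move: (Uup _ h); rewrite hz eqxx.
case: (closed_field_poly_normal U) => cs UE.
have lcU : lead_coef U = 2 by rewrite lead_coefE sU.
rewrite lcU in UE.
have n20 : (2 : C) != 0 by rewrite pnatr_eq0.
have Uroot z : (z \in cs) = (U.[z] == 0).
  by rewrite UE hornerZ mulf_eq0 (negPf n20) /= -rootE root_prod_XsubC.
have csE : cs = [seq x%:C | x <- [seq Re z | z <- cs]].
  rewrite -map_comp; apply/esym/map_id_in => z.
  by rewrite Uroot => /eqP/Ureal/real_of_Im0.
set xs := [seq Re z | z <- cs] in csE.
have UE' : U = 2 *: \prod_(x <- xs) ('X - x%:C%:P) by rewrite UE {1}csE big_map.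
have dU x : x \in xs -> exists2 k : R, k < 0 &
          U^`().[x%:C] = E.[x%:C] * ((0 +i* 1)%C * k%:C).
  move=> xx; have : x%:C \in cs by rewrite csE map_f.
  rewrite Uroot hornerD addr_eq0 => /eqP Ex.
  (* This sum collects the differences computed by [conj_pair_diff]; it is negative as every [Im p]
     is. *)
  exists (\sum_(p <- ps) (2 * Im p / ((x - Re p) ^+ 2 + Im p ^+ 2))).
    apply: sumr_lt0 => // p /hps h; rewrite pmulr_llt0; first by lra.
    by rewrite invr_gt0 ltr_wpDl ?sqr_ge0 // lt_def sqr_ge0 sqrf_eq0 lt_eqF.
  have nep p : Im p < 0 -> x%:C != p by move=> h; apply: contraTneq h => <- /=; rewrite ltxx.
  have nep' p : Im p < 0 -> x%:C != (p^*)%C.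
    by move=> h; apply: contraTneq h => /(congr1 Im); rewrite ImCJ /= => h; rewrite -[Im p]opprK -h oppr0 ltxx.
  have d1 : E^`().[x%:C] = E.[x%:C] * \sum_(p <- ps) (x%:C - p)^-1.
    rewrite -(@logderiv_prod _ ps); last by move=> p /hps /nep.
    rewrite mulrC divfK // -rootE root_prod_XsubC.
    by apply/negP => /hps /=; rewrite ltxx.
  have d2 : Es^`().[x%:C] = Es.[x%:C] * \sum_(p <- ps) (x%:C - (p^*)%C)^-1.
    have EsE : Es = \prod_(p <- map (@conjc R) ps) ('X - p%:P) by rewrite big_map.
    rewrite -(big_map (@conjc R) xpredT (fun p => (x%:C - p)^-1)).
    rewrite -(@logderiv_prod _ (map (@conjc R) ps)); last first.
      by move=> p /mapP [q /hps h ->]; exact: nep'.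
    rewrite -EsE mulrC divfK // -rootE EsE root_prod_XsubC.
    apply/negP => /mapP [q /hps h /(congr1 Im)]; rewrite ImCJ /=; lra.
  rewrite derivD hornerD d1 -/Es d2 -[Es.[_]]opprK -Ex mulNr -mulrBr; congr (_ * _).
  rewrite rmorph_sum mulr_sumr -sumrB big_seq [RHS]big_seq.
  by apply: eq_bigr => p /hps h; rewrite conj_pair_diff // lt_eqF.
have Eneq x : E.[x%:C] != 0.
  by rewrite -rootE root_prod_XsubC; apply/negP => /hps /=; rewrite ltxx.
exists xs; split => //.
- have: uniq cs.
    apply: uniq_deriv_prodXsubC => z zs.
    have /dU [k k0] : Re z \in xs by rewrite map_f.
    have <- : z = (Re z)%:C by apply/real_of_Im0/Ureal/eqP; rewrite -Uroot.
    rewrite UE derivZ hornerZ => e; apply/negP => /eqP h; move: e; rewrite h mulr0.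
    move/esym/eqP; rewrite !mulf_eq0.
    have -> : z = (Re z)%:C by apply/real_of_Im0/Ureal/eqP; rewrite -Uroot.
    rewrite (negPf (Eneq _)) /= eq_complex /= oner_eq0 andbF /=.
    by rewrite eq_complex /= eqxx andbT lt_eqF.
  by rewrite csE => /map_uniq.
- by move: sU; rewrite UE' size_scale // size_prod_XsubC => -[].
Qed.

(* A Poisson formula with finitely many nodes: for [E = B * ('X - conj w0)] the zeros
   [x] of [E] plus its conjugate are real, and [A(w0) / B(w0)] is a positive
   combination of the [A(x) / B(x)] up to the imaginary term [c * 'i * Im w0]. *)
Lemma Im_frac_gt0_monic (ps : seq C) (A : {poly C}) (c : R) w0 :
  let B := \prod_(p <- ps) ('X - p%:P) in
  (forall p, p \in ps -> Im p < 0) ->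
  (size A <= (size ps).+2)%N -> A`_(size ps).+1 = c%:C -> 0 < c ->
  (forall x : R, 0 < Im (A.[x%:C] / B.[x%:C])) ->
  0 < Im w0 -> 0 < Im (A.[w0] / B.[w0]).
Proof.
move=> B hps sA lA c0 hx hw.
have hps' p : p \in ((w0^*)%C :: ps) -> Im p < 0.
  by rewrite inE => /orP [/eqP ->|/hps //]; rewrite ImCJ oppr_lt0.
have [xs [uxs sxs UE dU]] := Hermite_Biehler_nodes (ps := (w0^*)%C :: ps) isT hps'.
move: UE dU; rewrite big_cons -/B.
set E := (_ * B); set U := (E + _) => UE dU.
set V := \prod_(x <- xs) ('X - x%:C%:P) in UE.
have VE : V = \prod_(x <- map (real_complex R) xs) ('X - x%:P) by rewrite big_map.
have n20 : (2 : C) != 0 by rewrite pnatr_eq0.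
(* The conjugate of [E] has the factor ['X - w0], so only [E] contributes to [U] at [w0]. *)
have Vw0 : 2 * V.[w0] = (w0 - (w0^*)%C) * B.[w0].
  rewrite -hornerZ -UE /U hornerD big_cons.
  by rewrite [X in _ + X]hornerM conjcK !hornerXsubC subrr mul0r addr0 /E hornerM hornerXsubC.
have Bneq z : 0 <= Im z -> B.[z] != 0.
  move=> hz; rewrite -rootE root_prod_XsubC; apply/negP => /hps; lra.
have w0x x : w0 != x%:C by apply: contraTneq hw => ->; rewrite ltxx.
have cVm : V \is monic by rewrite VE monic_prod_XsubC.
have sV : size V = (size ps).+2 by rewrite VE size_prod_XsubC size_map sxs.
(* [A] has one degree too many for interpolation at [xs]. Subtracting [c *: V] cancels its top
   coefficient without changing its values at the nodes, and produces the linear term of the Poisson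
   formula. *)
have sQ : (size (A - c%:C *: V)%R <= size (map (real_complex R) xs))%N.
  rewrite size_map sxs /=; apply/leq_sizeP => j.
  rewrite leq_eqVlt => /orP [/eqP <-|hj].
    have := monicP cVm; rewrite lead_coefE sV /= => e.
    by rewrite coefB coefZ e mulr1 lA subrr.
  rewrite coefB coefZ !nth_default ?mulr0 ?subrr // ?sV //.
  exact: leq_trans hj.
have uC : uniq (map (real_complex R) xs) by rewrite map_inj_uniq //; exact: complexI.
have w0n : w0 \notin map (real_complex R) xs.
  by apply/negP => /mapP [x _ e]; have := w0x x; rewrite e eqxx.
have V0 x : x \in xs -> V.[x%:C] = 0.
  by move=> xx; apply/rootP; rewrite VE root_prod_XsubC map_f.
have := lagrange_frac uC sQ w0n; rewrite /= -VE big_map.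
have Vw0n : V.[w0] != 0 by rewrite -rootE VE root_prod_XsubC.
have Bw0n : B.[w0] != 0 by rewrite Bneq // ltW.
rewrite {1}hornerD {1}hornerN {1}hornerZ mulrDl mulNr mulfK // => /eqP.
rewrite subr_eq => /eqP AV.
have iw : w0 - (w0^*)%C = 2 * ((0 +i* 1)%C * (Im w0)%:C).
  by rewrite subcJ -mulrA [X in _ * X]mulrC.
have VB : V.[w0] = (0 +i* 1)%C * (Im w0)%:C * B.[w0].
  by apply: (mulfI n20); rewrite Vw0 iw !mulrA.
have -> : A.[w0] / B.[w0] = A.[w0] / V.[w0] * ((0 +i* 1)%C * (Im w0)%:C).
  have kn : (0 +i* 1)%C * (Im w0)%:C != 0.
    by move: Vw0n; rewrite VB mulf_eq0 negb_or => /andP[].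
  have gen (a k b : C) : k != 0 -> b != 0 -> a / b = a / (k * b) * k.
    by move=> k0 b0; field; rewrite k0 b0.
  by rewrite VB; exact: gen.
rewrite AV mulrDl ImD ltr_wpDl //; last first.
  rewrite ImMr; have -> : Im ((0 +i* 1)%C * (Im w0)%:C) = Im w0 by rewrite /= mul0r mul1r add0r.
  by rewrite mulr_gt0.
rewrite mulr_suml Im_sum big_seq; apply: sumr_ge0 => x xx.
have [k k0 dUx] := dU x xx.
have Vx : V^`().[x%:C] = (x%:C - (w0^*)%C) * B.[x%:C] * ((0 +i* 1)%C * k%:C) / 2.
  apply: (mulfI n20); rewrite -hornerZ -derivZ -UE dUx hornerM hornerXsubC.
  by rewrite [RHS]mulrC divfK.
have Ax : (A - c%:C *: V).[x%:C] = A.[x%:C] by rewrite hornerD hornerN hornerZ V0 // mulr0 subr0.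
have N0 : 0 < (x - Re w0) ^+ 2 + Im w0 ^+ 2.
  by rewrite ltr_wpDl ?sqr_ge0 // exprn_gt0.
have NE : (x%:C - (w0^*)%C) * (w0 - x%:C) = - ((x - Re w0) ^+ 2 + Im w0 ^+ 2)%:C.
  case: (w0) => a b; apply/eqP; rewrite eq_complex /=.
  by apply/andP; split; apply/eqP; ring.
have Bx : B.[x%:C] != 0 by rewrite Bneq.
have xw1 : w0 - x%:C != 0 by rewrite subr_eq0.
have xw2 : x%:C - (w0^*)%C != 0.
  apply/negP => /eqP h; move: NE; rewrite h mul0r => /eqP.
  by rewrite eq_sym oppr_eq0 eq_complex /= eqxx andbT gt_eqF.
have kn : (k%:C : C) != 0 by rewrite eq_complex /= eqxx andbT lt_eqF.
have i0 : (0 +i* 1)%C != 0 :> C by rewrite eq_complex /= oner_eq0 andbF.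
rewrite Ax.
(* The factor [x - conj w0] of [V'] and the factor [w0 - x] multiply to minus the squared distance
   from [x] to [w0]. As [k < 0], the weight of [A(x) / B(x)] is positive. *)
have -> : A.[x%:C] / V^`().[x%:C] / (w0 - x%:C) * ((0 +i* 1)%C * (Im w0)%:C)
  = (2 * Im w0 / (- k * ((x - Re w0) ^+ 2 + Im w0 ^+ 2)))%:C * (A.[x%:C] / B.[x%:C]).
  have -> : (2 * Im w0 / (- k * ((x - Re w0) ^+ 2 + Im w0 ^+ 2)))%:C =
     2 * (Im w0)%:C / (k%:C * ((x%:C - (w0^*)%C) * (w0 - x%:C))).
    by rewrite NE fmorph_div !(rmorphM (real_complex R)) rmorphN rmorph_nat mulrN mulNr.
  by rewrite Vx; field; rewrite Bx xw1 xw2 kn i0.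
rewrite ImMr mulr_ge0 ?(ltW (hx _)) //.
by rewrite divr_ge0 ?mulr_ge0 ?oppr_ge0 ?ltW.
Qed.

(** Dividing both polynomials by the leading coefficient of [B] reduces to the monic case. The
    condition on the top coefficients says that [A / B] grows like [c w] at infinity. *)
Lemma Im_frac_gt0 (A B : {poly C}) n (c : R) w0 :
  size B = n.+1 -> (size A <= n.+2)%N -> A`_n.+1 = c%:C * B`_n -> 0 < c ->
  (forall w, 0 <= Im w -> B.[w] != 0) ->
  (forall x : R, 0 < Im (A.[x%:C] / B.[x%:C])) ->
  0 < Im w0 -> 0 < Im (A.[w0] / B.[w0]).
Proof.
move=> sB sA lA c0 hB hx hw.
case: (closed_field_poly_normal B) => ps BE.
have B0 : B != 0 by rewrite -size_poly_gt0 sB.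
have l0 : lead_coef B != 0 by rewrite lead_coef_eq0.
have sps : size ps = n.
  by move: sB; rewrite BE size_scale // size_prod_XsubC => -[].
have AB w : A.[w] / B.[w] =
   ((lead_coef B)^-1 *: A).[w] / (\prod_(p <- ps) ('X - p%:P)).[w].
  by rewrite {1}BE !hornerZ invfM mulrA [A.[w] / _]mulrC.
rewrite AB; apply: (Im_frac_gt0_monic (ps := ps) (c := c)) => //.
- move=> p pp; rewrite ltNge; apply/negP => /hB; rewrite BE hornerZ mulf_eq0 negb_or.
  by rewrite l0 /= -rootE root_prod_XsubC pp.
- by rewrite sps; apply: leq_trans (size_scale_leq _ _) sA.
- by rewrite coefZ sps lA lead_coefE sB /= mulrC mulfK // -[B`_n]/(B`_n.+1.-1) -sB -lead_coefE.
- by move=> x; rewrite -AB.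
Qed.

End HalfPlane.

(** * Polynomials restricted to lines *)

Section Line.
Variables (S : comNzRingType) (n : nat).
Implicit Types (g h p q : {mpoly S[n]}) (a b : 'rV[S]_n).

Definition line g a b : {poly S} :=
  mmap (@polyC S) (fun i => (a 0 i)%:P + (b 0 i)%:P * 'X) g.

Definition dird b g : {mpoly S[n]} := \sum_i b 0 i *: g^`M(i).

Lemma mpoly_ring_ind (P : {mpoly S[n]} -> Prop) :
  (forall c, P c%:MP) -> (forall i, P 'X_i) ->
  (forall p q, P p -> P q -> P (p + q)) -> (forall p q, P p -> P q -> P (p * q)) ->
  forall p, P p.
Proof.
move=> hC hX hD hM; elim/mpolyind => [|c m p _ _ Pp]; first by rewrite -(mpolyC0 n S).
apply: (hD) => //; rewrite -mul_mpolyC; apply: (hM) => //; rewrite mpolyXE_id.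
elim/big_ind: _ => [||i _]; [by rewrite -(mpolyC1 n S) | exact: hM |].
by elim: (m i) => [|k IH]; [rewrite expr0 -(mpolyC1 n S) | rewrite exprS; apply: hM].
Qed.

(** Ring morphisms out of a polynomial ring are compared on constants and variables; every later
    change of evaluation, base field or variables reduces to this. *)
Lemma mmap_comp (T1 T2 : comNzRingType) (f : {rmorphism S -> T1})
    (k : 'I_n -> T1) (phi : {rmorphism T1 -> T2}) (f' : {rmorphism S -> T2})
    (k' : 'I_n -> T2) p :
  (forall c, phi (f c) = f' c) -> (forall i, phi (k i) = k' i) ->
  phi (mmap f k p) = mmap f' k' p.
Proof.
move=> hf hk; elim/mpoly_ring_ind: p => [c|i|p q hp hq|p q hp hq].
- by rewrite !mmapC hf.
- by rewrite !mmapX !mmap1U hk.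
- by rewrite !mmapD rmorphD hp hq.
- by rewrite !rmorphM /= hp hq.
Qed.

Lemma line_horner g a b t : (line g a b).[t] = g.@[(a + t *: b) 0].
Proof.
elim/mpoly_ring_ind: g => [c|i|p q hp hq|p q hp hq].
- by rewrite /line mmapC mevalC hornerC.
- by rewrite /line mmapX mmap1U mevalXU !hornerE !mxE mulrC.
- by rewrite /line mmapD hornerD hp hq mevalD.
- by rewrite /line rmorphM /= hornerM [LHS]/= hp hq mevalM.
Qed.

Lemma line_meval0 g a b : (line g a b).[0] = g.@[a 0].
Proof. by rewrite line_horner scale0r addr0. Qed.

Lemma chain_rule (T : comNzRingType) (f : {rmorphism S -> T}) (k : 'I_n -> T)
    (delta : T -> T) p :
  (forall x y, delta (x + y) = delta x + delta y) ->
  (forall x y, delta (x * y) = delta x * y + x * delta y) ->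
  (forall c, delta (f c) = 0) ->
  delta (mmap f k p) = \sum_i mmap f k p^`M(i) * delta (k i).
Proof.
move=> dD dM dC; elim/mpoly_ring_ind: p => [c|i|p q hp hq|p q hp hq].
- rewrite mmapC dC big1 // => i _; by rewrite mderivC mmap0 mul0r.
- rewrite mmapX mmap1U (bigD1 i) //= big1 => [|j ji]; rewrite mderivX mnm1E.
    have -> : (U_(i) - U_(i))%MM = 0%MM by apply/mnmP => j; rewrite mnmBE subnn mnm0E.
    by rewrite eqxx scale1r mpolyX0 rmorph1 mul1r addr0.
  by rewrite eq_sym (negPf ji) scale0r mmap0 mul0r.
- rewrite mmapD dD hp hq -big_split /=; apply: eq_bigr => i _.
  by rewrite mderivD mmapD mulrDl.
- rewrite rmorphM /= dM hp hq mulr_suml mulr_sumr -big_split /=; apply: eq_bigr => i _.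
  by rewrite mderivM mmapD !rmorphM /=; ring.
Qed.

Lemma line_dird g a b c : line (dird c g) a b = \sum_i c 0 i *: line g^`M(i) a b.
Proof.
by rewrite /line /dird raddf_sum /=; apply: eq_bigr => i _; rewrite mmapZ mul_polyC.
Qed.

Lemma deriv_line g a b : (line g a b)^`() = line (dird b g) a b.
Proof.
rewrite line_dird {1}/line (@chain_rule _ _ _ (@deriv S) g).
- apply: eq_bigr => i _; rewrite derivD derivC add0r derivM derivC mul0r add0r.
  by rewrite derivX mulr1 mulrC mul_polyC.
- exact: derivD.
- exact: derivM.
- exact: derivC.
Qed.

Lemma dirdD b p q : dird b (p + q) = dird b p + dird b q.
Proof.
by rewrite /dird -big_split; apply: eq_bigr => i _; rewrite mderivD scalerDr.
Qed.

Lemma dirdN b p : dird b (- p) = - dird b p.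
Proof. by rewrite /dird -sumrN; apply: eq_bigr => i _; rewrite mderivN scalerN. Qed.

Lemma dirdM b p q : dird b (p * q) = dird b p * q + p * dird b q.
Proof.
rewrite /dird mulr_suml mulr_sumr -big_split /=; apply: eq_bigr => i _.
by rewrite mderivM scalerDr -scalerAl -scalerAr.
Qed.

Lemma dirdC b c g : dird b (dird c g) = dird c (dird b g).
Proof.
rewrite /dird.
under eq_bigr => i _ do rewrite (raddf_sum (@mderiv n S i)) scaler_sumr.
under [RHS]eq_bigr => i _ do rewrite (raddf_sum (@mderiv n S i)) scaler_sumr.
rewrite exchange_big /=; apply: eq_bigr => i _; apply: eq_bigr => j _.
by rewrite !mderivZ mderiv_comm !scalerA mulrC.
Qed.

Lemma dird_lin t b c g : dird (b + t *: c) g = dird b g + t *: dird c g.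
Proof.
rewrite /dird scaler_sumr -big_split; apply: eq_bigr => i _ /=.
by rewrite !mxE scalerDl scalerA.
Qed.

Lemma dird_sum (I : Type) (s : seq I) (F : I -> 'rV[S]_n) g :
  dird (\sum_(i <- s) F i) g = \sum_(i <- s) dird (F i) g.
Proof.
rewrite /dird exchange_big /=; apply: eq_bigr => i _.
by rewrite summxE scaler_suml.
Qed.

Lemma dhomog_deriv d h i : h \is d.-homog -> h^`M(i) \is d.-1.-homog.
Proof.
move=> /dhomogP hh; apply/dhomogP => m; rewrite mcoeff_msupp mcoeff_mderiv => hm.
have : (m + U_(i))%MM \in msupp h.
  by rewrite mcoeff_msupp; apply: contra_neq hm => ->; rewrite mul0rn.
by move=> /hh /=; rewrite mdegD mdeg1 addn1 => <-.
Qed.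

Lemma dhomog_dird d h b : h \is d.-homog -> dird b h \is d.-1.-homog.
Proof. by move=> hh; apply: rpred_sum => i _; apply/rpredZ/dhomog_deriv. Qed.

Lemma dhomog_meval d h (c : S) a : h \is d.-homog ->
  h.@[(c *: a) 0] = c ^+ d * h.@[a 0].
Proof.
move=> /dhomogP hh; rewrite !mevalE mulr_sumr big_seq [RHS]big_seq.
apply: eq_bigr => m /hh <-; rewrite mulrCA; congr (_ * _).
under eq_bigr => i _ do rewrite mxE exprMn.
by rewrite big_split /= prodrXr mdegE.
Qed.

Lemma dhomog_line d h a b : h \is d.-homog ->
  (size (line h a b) <= d.+1)%N /\ (line h a b)`_d = h.@[b 0].
Proof.
(* [T k p c] records a formal degree [k] with formal leading coefficient [c], possibly zero. Unlike
   the true leading coefficient, it is multiplicative without side conditions. *)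
pose T k (p : {poly S}) c := (size p <= k.+1)%N /\ p`_k = c.
have TM k l (p q : {poly S}) c c' : T k p c -> T l q c' -> T (k + l)%N (p * q) (c * c').
  move=> [sp <-] [sq <-]; split.
    apply: leq_trans (size_polyMleq _ _) _.
    by move: (leq_add sp sq); rewrite addSn addnS; case: (_ + _)%N.
  rewrite coefM (bigD1 (inord k)) //= inordK ?ltnS ?leq_addr // addKn.
  rewrite big1 ?addr0 // => i; rewrite -val_eqE /= inordK ?ltnS ?leq_addr // => ik.
  case: (ltngtP i k) ik => // ik _.
    rewrite [q`_ _]nth_default ?mulr0 //; apply: leq_trans sq _.
    by rewrite ltn_subRL ltn_add2r.
  by rewrite nth_default ?mul0r //; apply: leq_trans sp ik.
have TX m : T (mdeg m) (mmap1 (fun i => (a 0 i)%:P + (b 0 i)%:P * 'X) m)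
   (\prod_i b 0 i ^+ m i).
  rewrite mdegE /mmap1; elim/big_rec3: _ => [|i k p q _ IH].
    by split; rewrite ?size_poly1 // coef1.
  apply: (TM) IH; elim: (m i) => [|r IHr]; first by split; rewrite ?expr0 ?size_poly1 // coef1.
  rewrite !exprS -add1n; apply: (TM) IHr; split.
    apply: leq_trans (size_polyD _ _) _; rewrite geq_max.
    rewrite (leq_trans (size_polyC_leq1 _)) //=.
    by rewrite (leq_trans (size_polyMleq _ _)) // size_polyX addn2 /= ltnS size_polyC_leq1.
  by rewrite coefD coefC coefCM coefX /= mulr1 add0r.
move=> /dhomogP hh; rewrite mevalE /line /mmap.
suff: T d (\sum_(m <- msupp h) (h@_m)%:P * mmap1 (fun i => (a 0 i)%:P + (b 0 i)%:P * 'X) m)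
   (\sum_(m <- msupp h) h@_m * \prod_i b 0 i ^+ m i) by [].
rewrite big_seq [X in T _ _ X]big_seq; elim/big_rec2: _ => [|m c p mh [sp <-]].
  by split; rewrite ?size_poly0 ?coef0.
have [st ct] := TX m; rewrite (hh _ mh) in st ct; split.
  apply: leq_trans (size_polyD _ _) _; rewrite geq_max sp andbT mul_polyC.
  exact: leq_trans (size_scale_leq _ _) st.
by rewrite coefD coefCM ct.
Qed.

End Line.

(** * Hyperbolicity cones *)

Section Garding.
Variables (R : rcfType) (n : nat).
Notation C := (R[i]).
Notation Re := (@complex.Re R).
Notation Im := (@complex.Im R).
Notation "x %:C" := (real_complex R x).
Notation I := ((0 +i* 1)%C : C).
Implicit Types (h : {mpoly C[n]}) (e u v x : 'rV[R]_n) (z w : C) (b : 'rV[C]_n).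

Definition cvec (m : nat) (x : 'rV[R]_m) : 'rV[C]_m := map_mx (real_complex R) x.

Lemma cvecD m (x y : 'rV[R]_m) : cvec (x + y) = cvec x + cvec y.
Proof. exact: map_mxD. Qed.

Lemma cvecZ m (a : R) (x : 'rV[R]_m) : cvec (a *: x) = a%:C *: cvec x.
Proof. exact: map_mxZ. Qed.

Lemma cvecN m (x : 'rV[R]_m) : cvec (- x) = - cvec x.
Proof. exact: map_mxN. Qed.

Lemma cvec0 m : cvec (0 : 'rV[R]_m) = 0.
Proof. exact: map_mx0. Qed.

Lemma scale_cvec m z (v : 'rV[R]_m) :
  z *: cvec v = cvec (Re z *: v) + I *: cvec (Im z *: v).
Proof.
apply/rowP => i; rewrite !mxE; case: z => a c; apply/eqP.
by rewrite eq_complex /= !(mulr0, mul0r, mul1r, subr0, add0r, addr0) !eqxx.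
Qed.

Lemma shift_point x u v z :
  cvec x + I *: cvec u + z *: cvec v =
    cvec (x + Re z *: v) + I *: cvec (u + Im z *: v).
Proof. by rewrite (scale_cvec z) !cvecD scalerDr addrACA. Qed.

Lemma dhomog0_const h b (c : 'rV[C]_n) : h \is 0.-homog -> h.@[b 0] = h.@[c 0].
Proof.
move=> hh; have E (a : 'rV[C]_n) : h.@[a 0] = h.@[(0 : 'rV[C]_n) 0].
  by rewrite -(scale0r a) (dhomog_meval _ _ hh) expr0 mul1r.
by rewrite E [RHS]E.
Qed.

(** Real-rootedness in direction [e], phrased as nonvanishing on a half-plane. For homogeneous [h]
    the case of negative [a] follows on multiplying the point by -1. *)
Definition hyperbolic_at h e :=
  forall x (a : R), 0 < a -> h.@[(cvec x + I *: cvec (a *: e)) 0] != 0.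

Lemma hyperbolic_at_dir d h e : h \is d.-homog -> hyperbolic_at h e -> h.@[cvec e 0] != 0.
Proof.
move=> hh /(_ 0 1 ltr01); rewrite cvec0 add0r scale1r (dhomog_meval _ _ hh).
by rewrite mulf_eq0 negb_or => /andP[].
Qed.

Lemma hyperbolic_at_Im0 d h e x z : h \is d.-homog -> hyperbolic_at h e ->
  h.@[(cvec x + z *: cvec e) 0] = 0 -> Im z = 0.
Proof.
move=> hh he h0; case: (ltgtP (Im z) 0) => // hz; exfalso.
  have h1 : h.@[(-1 *: (cvec x + z *: cvec e)) 0] = 0.
    by rewrite (dhomog_meval _ _ hh) h0 mulr0.
  have := he (- x - Re z *: e) (- Im z); rewrite oppr_gt0 => /(_ hz).
  suff <- : -1 *: (cvec x + z *: cvec e) =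
     cvec (- x - Re z *: e) + I *: cvec (- Im z *: e) by rewrite h1 eqxx.
  rewrite scaleN1r opprD (scale_cvec z) !cvecD !cvecN scaleNr cvecN scalerN.
  by rewrite opprD addrA.
have := he (x + Re z *: e) (Im z) hz.
by rewrite cvecD -addrA -scale_cvec h0 eqxx.
Qed.

(** Gauss-Lucas on the complex line through [b] in direction [e]. The restriction is not constant
    because its coefficient of degree [d.+1] is [h] at [e]. *)
Lemma dird_ratio d h e b : h \is d.+1.-homog -> h.@[cvec e 0] != 0 ->
  (forall z, 0 <= Im z -> h.@[(b + z *: cvec e) 0] != 0) ->
  (dird (cvec e) h).@[b 0] != 0 /\ 0 < Im (h.@[b 0] / (dird (cvec e) h).@[b 0]).
Proof.
move=> hh he hb; pose f := line h b (cvec e).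
have [_ cf] := dhomog_line b (cvec e) hh.
have sf : (1 < size f)%N.
  rewrite ltnNge; apply/negP => s1; move: he; rewrite -cf nth_default ?eqxx //.
  exact: leq_trans s1 _.
have := @Im_logderiv_lt0 R f 0; rewrite /= {1}/f.
rewrite deriv_line !line_meval0 => /(_ _ sf) H.
have {}H : Im ((dird (cvec e) h).@[b 0] / h.@[b 0]) < 0.
  by apply: H => z hz; rewrite line_horner hb.
split; first by apply: contraTneq H => ->; rewrite mul0r ltxx.
by rewrite -invf_div; exact: ImV_gt0.
Qed.

(** The zeros of [h] on the line through [v] in direction [e] are real by hyperbolicity and negative
    by hypothesis, so the logarithmic derivative at [v] is a sum of positive terms. *)
Lemma dird_ratio_real d h e v : h \is d.+1.-homog -> hyperbolic_at h e ->
  (forall s : R, 0 <= s -> h.@[cvec (v + s *: e) 0] != 0) ->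
  exists2 c : R, 0 < c &
    (dird (cvec e) h).@[cvec v 0] = c%:C * h.@[cvec v 0].
Proof.
move=> hh he hv; pose f := line h (cvec v) (cvec e).
have [_ cf] := dhomog_line (cvec v) (cvec e) hh.
have sf : (1 < size f)%N.
  rewrite ltnNge; apply/negP => s1.
  move: (hyperbolic_at_dir hh he); rewrite -cf nth_default ?eqxx //.
  exact: leq_trans s1 _.
have [z|c c0] := logderiv0_gt0 sf.
  rewrite line_horner => hz; have iz := hyperbolic_at_Im0 hh he hz.
  have zE := real_of_Im0 iz; exists (Re z) => //; rewrite ltNge; apply/negP => z0.
  by have := hv _ z0; rewrite cvecD cvecZ -zE hz eqxx.
by rewrite deriv_line !line_meval0 => E; exists c.
Qed.

(** Induction on the degree, from [dird (cvec e) h] to [h]. On the line [w] maps to [x + i u + w v],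
    the denominator of [h / D_e h] has no zero in the closed upper half-plane by induction, and the
    quotient has positive imaginary part at real [w] by [dird_ratio]. [Im_frac_gt0] extends this to
    the upper half-plane, where [h] therefore cannot vanish. Keeping [K] abstract allows a cone to
    be enlarged by one generator at a time. *)
Lemma nonvanishing_add_dir d h e v (K : 'rV[R]_n -> Prop) :
  h \is d.-homog ->
  (forall u (a : R), K u -> 0 <= a -> K (u + a *: e)) ->
  (forall x u, K u -> h.@[(cvec x + I *: cvec u) 0] != 0) ->
  hyperbolic_at h e ->
  (forall s : R, 0 <= s -> h.@[cvec (v + s *: e) 0] != 0) ->
  forall x u w, K u -> 0 <= Im w ->
    h.@[(cvec x + I *: cvec u + w *: cvec v) 0] != 0.
Proof.
move=> + Ke; elim: d h => [|d IH] h hh hK he hv x u w Ku hw.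
  by rewrite (dhomog0_const _ (cvec (v + 0 *: e)) hh) hv.
have hee := hyperbolic_at_dir hh he.
have stepK y u' z : K u' -> 0 <= Im z ->
    h.@[(cvec y + I *: cvec u' + z *: cvec e) 0] != 0.
  by move=> Ku' hz; rewrite shift_point; apply: (hK); apply: (Ke).
have ratioK y u' : K u' -> _ := fun Ku' => dird_ratio hh hee (fun z => stepK y u' z Ku').
have kh : dird (cvec e) h \is d.-homog by have := dhomog_dird (cvec e) hh.
have IHk : forall x u w, K u -> 0 <= Im w ->
    (dird (cvec e) h).@[(cvec x + I *: cvec u + w *: cvec v) 0] != 0.
  apply: (IH) => //.
  - by move=> y u' /(ratioK y) [].
  - move=> y a a0; have [] // := dird_ratio (b := cvec y + I *: cvec (a *: e)) hh hee.
    move=> z hz; rewrite shift_point -scalerDl; apply: (he).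
    exact: ltr_wpDr.
  - move=> s s0; have [|c c0 ->] := @dird_ratio_real d h e (v + s *: e) hh he.
      by move=> s' s'0; rewrite -addrA -scalerDl hv // addr_ge0.
    by rewrite mulf_neq0 ?hv // eq_complex /= eqxx andbT gt_eqF.
move: hw; rewrite le_eqVlt => /orP [/eqP w0|hw].
  by rewrite shift_point -w0 scale0r addr0 hK.
have [c c0 cE] := dird_ratio_real hh he hv.
pose b := cvec x + I *: cvec u.
have [sA lA] := dhomog_line b (cvec v) hh.
have [sB lB] := dhomog_line b (cvec v) kh.
have hv0 : h.@[cvec v 0] != 0 by have := hv 0 (lexx _); rewrite scale0r addr0.
have kv0 : (dird (cvec e) h).@[cvec v 0] != 0.
  by rewrite cE mulf_neq0 // eq_complex /= eqxx andbT gt_eqF.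
have sB' : size (line (dird (cvec e) h) b (cvec v)) = d.+1.
  apply/eqP; rewrite eqn_leq sB /=; apply: contraT; rewrite -leqNgt => s1.
  by move: kv0; rewrite -lB nth_default ?eqxx.
have : 0 < Im ((line h b (cvec v)).[w] / (line (dird (cvec e) h) b (cvec v)).[w]).
  (* The top coefficients of the two restrictions are the values of [h] and [D_e h] at [v], whose
     ratio is [c^-1]. *)
  apply: (Im_frac_gt0 (c := c^-1) sB' sA) => //.
  - rewrite lA lB cE mulrA -rmorphM mulVf ?mul1r //; exact: lt0r_neq0.
  - by rewrite invr_gt0.
  - by move=> w' hw'; rewrite line_horner; exact: IHk.
  - move=> r; rewrite !line_horner /b -cvecZ addrAC -cvecD.
    by case: (ratioK (x + r *: v) u Ku).
rewrite !line_horner -/b; apply: contraTneq => ->.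
by rewrite mul0r ltxx.
Qed.

(** The cone of the [a e + sum b_v v] with [a > 0] and all [b_v >= 0]. The recursion peels off one
    generator, matching the induction of [nonvanishing_open_cone]. *)
Fixpoint open_cone e (vs : seq 'rV[R]_n) u : Prop :=
  match vs with
  | [::] => exists2 a : R, 0 < a & u = a *: e
  | v :: vs' => exists2 b : R, 0 <= b & open_cone e vs' (u - b *: v)
  end.

Lemma open_cone_add_dir e vs u (a : R) :
  open_cone e vs u -> 0 <= a -> open_cone e vs (u + a *: e).
Proof.
move=> + a0; elim: vs u => [|v vs IH] u /=.
  by case=> c c0 ->; exists (c + a); rewrite ?scalerDl // ltr_wpDr.
by case=> b b0 hb; exists b => //; rewrite addrAC; apply: (IH).
Qed.

Lemma open_cone_dir e vs (a : R) : 0 < a -> open_cone e vs (a *: e).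
Proof.
move=> a0; elim: vs => [|v vs IH] /=; first by exists a.
by exists 0; rewrite ?scale0r ?subr0.
Qed.

Lemma open_cone_add_mem e vs u v (b : R) :
  open_cone e vs u -> v \in vs -> 0 <= b -> open_cone e vs (u + b *: v).
Proof.
move=> + + b0; elim: vs u => // v' vs IH u /= [c c0 hc].
rewrite inE => /orP [/eqP ->|vvs].
  exists (c + b); rewrite ?addr_ge0 // scalerDl.
  by rewrite opprD addrACA subrr addr0.
by exists c => //; rewrite addrAC; apply: (IH).
Qed.

Lemma open_cone_shrink e vs u : open_cone e vs u ->
  exists2 a : R, 0 < a & open_cone e vs (u - a *: e).
Proof.
elim: vs u => [|v vs IH] u /=.
  case=> a a0 ->; exists (a / 2); first by rewrite divr_gt0.
  exists (a / 2); first by rewrite divr_gt0.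
  by rewrite -scalerBl; congr (_ *: _); lra.
by case=> b b0 /IH [a a0 ha]; exists a => //; exists b => //; rewrite addrAC.
Qed.

Lemma open_cone_scale e vs u (c : R) : 0 < c -> open_cone e vs u ->
  open_cone e vs (c *: u).
Proof.
move=> c0; elim: vs u => [|v vs IH] u /=.
  by case=> a a0 ->; exists (c * a); rewrite ?mulr_gt0 // scalerA.
case=> b b0 /IH hb; exists (c * b); first by rewrite mulr_ge0 // ltW.
by rewrite -scalerA -scalerBr.
Qed.

(** Generators are added one by one with [nonvanishing_add_dir]. A generator [v] may itself be a
    zero of [h], so [v + c e] is added instead, and the excess [b c e] is taken from the positive
    part of [u] along [e]. *)
Lemma nonvanishing_open_cone d h e vs :
  h \is d.-homog -> hyperbolic_at h e ->
  (forall v (s : R), v \in vs -> 0 < s -> h.@[cvec (v + s *: e) 0] != 0) ->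
  forall x u, open_cone e vs u -> h.@[(cvec x + I *: cvec u) 0] != 0.
Proof.
move=> hh he; elim: vs => [|v vs IH] hv x u /=.
  by case=> a a0 ->; exact: he.
case=> b b0 /open_cone_shrink [a a0 hu].
(* This makes [b c] at most the available slack [a]; the [+ 1] covers [b = 0]. *)
pose c := a / (b + 1).
have b1 : 0 < b + 1 by rewrite ltr_wpDl.
have c0 : 0 < c by rewrite divr_gt0.
have bc : b * c <= a.
  by rewrite /c mulrA ler_pdivrMr // mulrC ler_pM2l // lerDl.
have hIH : forall x u, open_cone e vs u -> h.@[(cvec x + I *: cvec u) 0] != 0.
  by apply: IH => v' s v's; apply: hv; rewrite inE v's orbT.
have hv' s : 0 <= s -> h.@[cvec (v + c *: e + s *: e) 0] != 0.
  by move=> s0; rewrite -addrA -scalerDl hv ?mem_head // ltr_wpDr.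
have Ku : open_cone e vs (u - b *: v - (b * c) *: e).
  have := open_cone_add_dir hu; rewrite -subr_ge0 in bc => /(_ _ bc).
  by rewrite scalerBl addrA subrK.
have := @nonvanishing_add_dir d h e (v + c *: e) (open_cone e vs) hh
  (@open_cone_add_dir e vs) hIH he hv' x _ (0 +i* b)%C Ku b0.
rewrite shift_point /= scale0r addr0.
by rewrite scalerDr scalerA [b *: v + _]addrC addrA subrK subrK.
Qed.

End Garding.

(** * Barriers *)

Section Barrier.
Variable R : rcfType.
Notation C := (R[i]).
Notation Re := (@complex.Re R).
Notation Im := (@complex.Im R).
Notation "x %:C" := (real_complex R x).
Notation toC := (map_poly (real_complex R)).
Notation I := ((0 +i* 1)%C : C).

Lemma real_rooted_split (p : {poly R}) :
  (forall z, (toC p).[z] = 0 -> Im z = 0) ->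
  exists rs, p = lead_coef p *: \prod_(r <- rs) ('X - r%:P).
Proof.
move=> hp; case: (closed_field_poly_normal (toC p)) => cs pE.
have [p0|p0] := eqVneq p 0; first by exists [::]; rewrite p0 lead_coef0 scale0r.
have l0 : lead_coef (toC p) != 0 by rewrite lead_coef_eq0 map_poly_eq0.
have csE : cs = [seq x%:C | x <- [seq Re z | z <- cs]].
  rewrite -map_comp; apply/esym/map_id_in => z zs /=; apply/esym/real_of_Im0/hp.
  by rewrite pE hornerZ; apply/eqP; rewrite mulf_eq0 -rootE root_prod_XsubC zs orbT.
exists [seq Re z | z <- cs]; apply: (map_poly_inj (real_complex R)).
rewrite pE lead_coef_map {1}csE map_polyZ big_map; congr (_ *: _).
by rewrite rmorph_prod; apply: eq_bigr => r _; rewrite rmorphB /= map_polyX map_polyC.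
Qed.

(** The third hypothesis says that [N / D] does not take the value [i] in the upper half-plane.
    Common roots are divided out by induction; afterwards the roots of [D] are simple and the
    residues [N / D'] positive. A polynomial identity is stated, not one of quotients, so that it
    survives multiplication by a common factor. *)
Lemma partial_fractions (rs : seq R) (a : R) (N : {poly R}) :
  let D := a *: \prod_(r <- rs) ('X - r%:P) in
  a != 0 -> (size N <= size rs)%N ->
  (forall w : C, 0 < Im w -> (toC N).[w] - I * (toC D).[w] != 0) ->
  exists l : seq (R * R), N = \sum_(p <- l) p.1 *: (D %/ ('X - p.2%:P)) /\
    forall p, p \in l -> 0 <= p.1 /\ root D p.2.
Proof.
move=> D a0; have [k] := ubnP (size rs).
elim: k rs @D N => // k IH rs D N; rewrite ltnS => hrs sN hE.
have rootD r : root D r = (r \in rs).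
  by rewrite /D rootE hornerZ mulf_eq0 (negPf a0) /= -rootE root_prod_XsubC.
case: (boolP (has (root N) rs)) => [/hasP [r rs_r Nr]|hN].
  pose rs1 := rem r rs; pose D1 := a *: \prod_(r <- rs1) ('X - r%:P).
  have DE : D = ('X - r%:P) * D1.
    by rewrite /D (perm_big _ (perm_to_rem rs_r)) big_cons scalerAr.
  have [N1 NE] := factor_theorem N r Nr.
  have s1 : size rs1 = (size rs).-1 by rewrite size_rem.
  have sr : (0 < size rs)%N by case: (rs) rs_r.
  have sN1 : (size N1 <= size rs1)%N.
    have [->|N10] := eqVneq N1 0; first by rewrite size_poly0.
    move: sN; rewrite NE size_Mmonic ?monicXsubC // size_XsubC addn2 /= s1.
    by case: (size rs).
  have [||l [lE lP]] := IH rs1 N1 _ sN1.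
  - by rewrite s1 (leq_trans _ hrs) // ltn_predL.
  - move=> w hw; have := hE w hw; rewrite DE NE !rmorphM /= !hornerM.
    rewrite rmorphB /= map_polyX map_polyC hornerXsubC mulrCA [_ * (w - _)]mulrC -mulrBr.
    by rewrite mulf_eq0 negb_or => /andP[].
  exists l; split; last by move=> p /lP [? ?]; rewrite DE rootM; split=> //; apply/orP; right.
  rewrite NE lE mulr_suml big_seq [RHS]big_seq; apply: eq_bigr => p /lP [_ rp].
  rewrite -scalerAl; congr (_ *: _).
  have X0 : 'X - p.2%:P != 0 by rewrite polyXsubC_eq0.
  have D1E : D1 = D1 %/ ('X - p.2%:P) * ('X - p.2%:P) by rewrite divpK // dvdp_XsubCl.
  by rewrite DE [in RHS]D1E mulrA mulpK // mulrC.
pose E := (toC N) - I *: (toC D).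
have EE w : E.[w] = (toC N).[w] - I * (toC D).[w] by rewrite hornerD hornerN hornerZ.
have sD : size D = (size rs).+1 by rewrite /D size_scale // size_prod_XsubC.
have i0 : I != 0 by rewrite eq_complex /= oner_eq0 andbF.
have realE (x : R) : E.[x%:C] = (N.[x] +i* - D.[x])%C.
  rewrite EE !horner_map /=; apply/eqP.
  by rewrite eq_complex /= !(mulr0, mul0r, mul1r, subr0, add0r, addr0, oppr0) !eqxx.
have Eup z : 0 <= Im z -> E.[z] != 0.
  rewrite le_eqVlt => /orP [/eqP z0|/hE]; last by rewrite EE.
  rewrite (real_of_Im0 (esym z0)) realE eq_complex /= negb_and oppr_eq0.
  have [Nz|//] := eqVneq N.[Re z] 0; apply/negP => /eqP Dz.
  move/hasPn: hN => /(_ (Re z)); rewrite -rootD rootE Dz eqxx => /(_ isT).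
  by rewrite rootE Nz eqxx.
(* At a root [r] of [D] the value of [E = N - i D] is the real number [N(r)], so the imaginary part
   of [E' / E] is [- D'(r) / N(r)], negative by Gauss-Lucas. *)
have key r : r \in rs -> 0 < N.[r] / D^`().[r].
  move=> rr; have Dr : D.[r] = 0 by apply/rootP; rewrite rootD.
  have sE : (1 < size E)%N.
    rewrite ltnNge; apply/negP => s1.
    have: E`_(size rs) != 0.
      rewrite coefB coefZ !coef_map /= (nth_default _ sN) sub0r oppr_eq0 mulf_neq0 //.
      rewrite eq_complex /= eqxx andbT.
      have: lead_coef D != 0 by rewrite lead_coef_eq0 -size_poly_gt0 sD.
      by rewrite lead_coefE sD.
    rewrite nth_default ?eqxx //; apply: leq_trans s1 _.
    by case: (rs) rr.
  have := Im_logderiv_lt0 (f := E) (w := r%:C) Eup sE.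
  rewrite realE Dr oppr0.
  have -> : E^`().[r%:C] = (N^`().[r] +i* - D^`().[r])%C.
    rewrite /E derivB derivZ !deriv_map hornerD hornerN hornerZ !horner_map /=; apply/eqP.
    by rewrite eq_complex /= !(mulr0, mul0r, mul1r, subr0, add0r, addr0, oppr0) !eqxx.
  move/hasPn: hN => /(_ _ rr); rewrite rootE => Nr.
  have -> : (N.[r] +i* 0)%C = N.[r]%:C by [].
  rewrite -fmorphV mulrC ImMr /= mulrN oppr_lt0 => h.
  by rewrite -invr_gt0 invf_div mulrC.
have dD r : r \in rs -> D^`().[r] != 0.
  by move=> /key; apply: contraTneq => ->; rewrite invr0 mulr0 ltxx.
pose V := \prod_(r <- rs) ('X - r%:P).
have dDV r : D^`().[r] = a * V^`().[r] by rewrite /D derivZ hornerZ.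
have urs : uniq rs.
  apply: uniq_deriv_prodXsubC => r /dD; rewrite dDV.
  by rewrite mulf_eq0 negb_or => /andP[].
exists [seq (N.[r] / D^`().[r], r) | r <- rs]; split; last first.
  by move=> p /mapP [r rr ->] /=; rewrite rootD rr ltW ?key.
rewrite big_map {1}(lagrange_prodXsubC urs sN) -/V; apply: eq_bigr => r _ /=.
rewrite divpZl scalerA dDV; congr (_ *: _).
by rewrite invfM mulrA mulrAC divfK.
Qed.

(** On [s >= 0] the quotient [N / D] is a sum of terms [c / (s - r)] with [c >= 0] and [r < 0], each
    decreasing and convex. [W] is its derivative at [t], and the last inequality puts the tangent at
    [t] below the graph at 0. *)
Lemma partial_fractions_convex (N D : {poly R}) (l : seq (R * R)) (t : R) :
  N = \sum_(p <- l) p.1 *: (D %/ ('X - p.2%:P)) ->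
  (forall p, p \in l -> 0 <= p.1 /\ root D p.2) ->
  (forall s, 0 <= s -> D.[s] != 0) -> 0 <= t ->
  let W := (N^`().[t] * D.[t] - N.[t] * D^`().[t]) / D.[t] ^+ 2 in
  [/\ W <= 0, N.[t] / D.[t] <= N.[0] / D.[0]
    & N.[t] / D.[t] - t * W <= N.[0] / D.[0]].
Proof.
move=> NE lP hD t0 W.
have rneg p : p \in l -> p.2 < 0.
  by move=> /lP [_ /rootP h]; rewrite ltNge; apply/negP => /hD; rewrite h eqxx.
have DE p : p \in l -> D = ('X - p.2%:P) * (D %/ ('X - p.2%:P)).
  by move=> /lP [_ h]; rewrite mulrC divpK // dvdp_XsubCl.
have PE p s : p \in l -> 0 <= s -> (D %/ ('X - p.2%:P)).[s] = D.[s] / (s - p.2).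
  move=> pl s0; rewrite [in RHS](DE p pl) hornerM hornerXsubC mulrAC mulfV ?mul1r //.
  by rewrite subr_eq0 gt_eqF // (lt_le_trans (rneg p pl)).
have NDE s : 0 <= s -> N.[s] / D.[s] = \sum_(p <- l) p.1 / (s - p.2).
  move=> s0; rewrite {1}NE horner_sum mulr_suml big_seq [RHS]big_seq.
  apply: eq_bigr => p pl; rewrite hornerZ PE // -mulrA; congr (_ * _); by rewrite mulrAC mulfV ?mul1r ?hD.
have WE : W = - \sum_(p <- l) p.1 / (t - p.2) ^+ 2.
  rewrite /W {1 2}NE raddf_sum /= !horner_sum !mulr_suml -sumrB mulr_suml -sumrN.
  rewrite big_seq [RHS]big_seq; apply: eq_bigr => p pl.
  have tp : t - p.2 != 0 by rewrite subr_eq0 gt_eqF // (lt_le_trans (rneg p pl)).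
  have dP : D^`().[t] = (D %/ ('X - p.2%:P)).[t] + (t - p.2) * (D %/ ('X - p.2%:P))^`().[t].
    by rewrite {1}(DE p pl) derivM derivXsubC mul1r hornerD hornerM hornerXsubC.
  rewrite derivZ !hornerZ dP PE //.
  by field; rewrite tp hD.
have tp p : p \in l -> 0 < t - p.2.
  by move=> pl; rewrite subr_gt0 (lt_le_trans (rneg p pl)).
have W0 : W <= 0.
  rewrite WE oppr_le0 big_seq; apply: sumr_ge0 => p pl.
  by rewrite divr_ge0 ?sqr_ge0 //; case: (lP p pl).
have key : N.[t] / D.[t] - t * W <= N.[0] / D.[0].
  rewrite !NDE // WE mulrN opprK mulr_sumr -big_split /=.
  rewrite big_seq [X in _ <= X]big_seq; apply: ler_sum => p pl.
  have [c0 _] := lP p pl; have r0 := rneg p pl; have tp' := tp p pl.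
  have -> : p.1 / (t - p.2) + t * (p.1 / (t - p.2) ^+ 2) =
     p.1 * ((t - p.2 + t) / (t - p.2) ^+ 2) by field; rewrite gt_eqF.
  apply: ler_wpM2l => //; rewrite sub0r ler_pdivrMr ?exprn_gt0 // mulrC.
  by rewrite ler_pdivlMr ?oppr_gt0 //; nra.
split => //; apply: le_trans key; rewrite lerBrDl gerDr.
exact: mulr_ge0_le0.
Qed.

End Barrier.

(** * Stability with respect to a cone, and evolution of the barriers *)

Section Stable.
Variables (R : rcfType) (n : nat).
Notation C := (R[i]).
Notation Re := (@complex.Re R).
Notation Im := (@complex.Im R).
Notation "x %:C" := (real_complex R x).
Notation toC := (map_mpoly (real_complex R)).
Notation I := ((0 +i* 1)%C : C).
Implicit Types (g c : {mpoly R[n]}) (x u v : 'rV[R]_n).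

Lemma toCB g g' : toC (g - g') = toC g - toC g'.
Proof. exact: mmapB. Qed.

Lemma toCM g g' : toC (g * g') = toC g * toC g'.
Proof. exact: (rmorphM (map_mpoly (real_complex R))). Qed.

Lemma meval_toC g x : (toC g).@[cvec x 0] = (g.@[x 0])%:C.
Proof.
pose k i := (x 0 i)%:C.
transitivity (mmap (real_complex R) k g).
  apply: (mmap_comp (phi := meval (cvec x 0))) => [c|i] /=; first by rewrite mevalC.
  by rewrite mevalXU mxE.
by apply/esym/(mmap_comp (phi := real_complex R)).
Qed.

Lemma line_toC g x u : map_poly (real_complex R) (line g x u) = line (toC g) (cvec x) (cvec u).
Proof.
pose k i := (x 0 i)%:C%:P + (u 0 i)%:C%:P * 'X.
transitivity (mmap (@polyC C \o real_complex R) k g).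
  apply: (mmap_comp (phi := map_poly (real_complex R))) => [c|i] /=.
    by rewrite map_polyC.
  by rewrite rmorphD rmorphM /= map_polyX !map_polyC.
apply/esym/(mmap_comp (phi := mmap (@polyC C) _)) => [c|i] /=; first by rewrite mmapC.
by rewrite mmapX mmap1U !mxE.
Qed.

Lemma mderiv_toC g i : toC g^`M(i) = (toC g)^`M(i).
Proof.
by apply/mpolyP => m; rewrite mcoeff_map_mpoly !mcoeff_mderiv mcoeff_map_mpoly raddfMn.
Qed.

Lemma dird_toC g u : toC (dird u g) = dird (cvec u) (toC g).
Proof.
rewrite /dird rmorph_sum; apply: eq_bigr => i _ /=.
by rewrite map_mpolyZ mderiv_toC mxE.
Qed.

Lemma dhomog_toC d g : g \is d.-homog -> toC g \is d.-homog.
Proof.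
move=> /dhomogP hg; apply/dhomogP => m; rewrite mcoeff_msupp mcoeff_map_mpoly => h.
by apply: hg; rewrite mcoeff_msupp; apply: contra_neq h => ->; rewrite raddf0.
Qed.

Variables (e : 'rV[R]_n) (vs : seq 'rV[R]_n).
Notation K := (open_cone e vs).

Definition stable g := forall x u, K u -> (toC g).@[(cvec x + I *: cvec u) 0] != 0.

(** The case [u = 0] is listed separately because [K] demands a positive coefficient at [e]. *)
Definition above g x := forall u, u = 0 \/ K u -> g.@[(x + u) 0] != 0.

Definition barrier v g x := (dird v g).@[x 0] / g.@[x 0].

Lemma stable_hyperbolic g u : stable g -> K u -> hyperbolic_at (toC g) u.
Proof. by move=> hg Ku x a a0; apply: hg; apply: open_cone_scale. Qed.

Lemma stable_dir d g u : g \is d.-homog -> stable g -> K u -> g.@[u 0] != 0.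
Proof.
move=> hg sg Ku; have := hyperbolic_at_dir (dhomog_toC hg) (stable_hyperbolic sg Ku).
by rewrite meval_toC; apply: contra_neq => ->.
Qed.

Lemma stable_half_plane g x u v z : stable g -> K u -> v \in vs -> 0 <= Im z ->
  (line (toC g) (cvec x + I *: cvec u) (cvec v)).[z] != 0.
Proof.
move=> sg Ku vvs hz; rewrite line_horner shift_point; apply: sg.
exact: open_cone_add_mem.
Qed.

(** A zero would make the logarithmic derivative of [g] in direction [v] equal to the inverse of a
    real number, whereas its imaginary part is negative. The hypothesis on [c] holds for the
    [y]-variables, on which the cone has no component. *)
Lemma stable_op g c v : stable g -> v \in vs ->
  (forall x u, K u -> (toC c).@[(cvec x + I *: cvec u) 0] = (c.@[x 0])%:C) ->
  stable (g - c * dird v g).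
Proof.
move=> sg vvs hc x u Ku; set b := cvec x + I *: cvec u.
have -> : (toC (g - c * dird v g)).@[b 0] =
    (toC g).@[b 0] - (c.@[x 0])%:C * (dird (cvec v) (toC g)).@[b 0].
  by rewrite toCB mevalB toCM mevalM dird_toC; congr (_ - _ * _); exact: hc.
pose f := line (toC g) b (cvec v).
have hf z : 0 <= Im z -> f.[z] != 0 by apply: stable_half_plane.
have f00 : f.[0] = (toC g).@[b 0] by rewrite line_meval0.
have f10 : f^`().[0] = (dird (cvec v) (toC g)).@[b 0] by rewrite deriv_line line_meval0.
rewrite -f00 -f10 subr_eq0; move: (c.@[x 0]) => {hc} a.
case: (leqP (size f) 1) => sf.
  have -> : f^`().[0] = 0 by rewrite {1}(size1_polyC sf) derivC horner0.
  by rewrite mulr0 hf.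
have := Im_logderiv_lt0 (w := 0) hf sf.
apply: contraTneq => fE.
have [c0|c0] := eqVneq a 0.
  by have := hf 0 (lexx _); rewrite fE c0 mul0r eqxx.
have ic : a%:C != 0 by rewrite eq_complex /= eqxx andbT.
rewrite fE -(invf_div) mulfK; last first.
  by apply: contra_neq (hf 0 (lexx _)) => h; rewrite fE h mulr0.
by rewrite -fmorphV /= ltxx.
Qed.

(** Along [x + s u] the barrier is a quotient of univariate polynomials to which the partial
    fraction expansion applies; [W] is its derivative at [s = t]. *)
Lemma barrier_convex d g x u v t : g \is d.+1.-homog -> stable g -> above g x ->
  K u -> v \in vs -> 0 <= t ->
  let p := x + t *: u in
  let W := ((dird u (dird v g)).@[p 0] * g.@[p 0]
             - (dird v g).@[p 0] * (dird u g).@[p 0]) / g.@[p 0] ^+ 2 in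
  [/\ W <= 0, barrier v g p <= barrier v g x & barrier v g p - t * W <= barrier v g x].
Proof.
move=> hg sg ag Ku vvs t0 p W.
pose D := line g x u; pose N := line (dird v g) x u.
have [sD lD] := dhomog_line x u hg.
have [sN _] : (size N <= d.+1)%N /\ _ := dhomog_line x u (dhomog_dird v hg).
have gu := stable_dir hg sg Ku.
have sD' : size D = d.+2.
  apply/eqP; rewrite eqn_leq sD /=; apply: contraT; rewrite -leqNgt => s1.
  by move: gu; rewrite -lD nth_default ?eqxx.
have DC := line_toC g x u; have NC := line_toC (dird v g) x u.
have Dh := line_horner g x u; have Nh := line_horner (dird v g) x u.
have D'h := deriv_line g x u; have N'h := deriv_line (dird v g) x u.
rewrite -/D in DC Dh D'h; rewrite -/N in NC Nh N'h.
have D'h' s : D^`().[s] = (dird u g).@[(x + s *: u) 0] by rewrite D'h line_horner.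
have N'h' s : N^`().[s] = (dird u (dird v g)).@[(x + s *: u) 0] by rewrite N'h line_horner.
clearbody D N; have [z|rs DE] := @real_rooted_split R D.
  rewrite DC line_horner => hz.
  exact: (hyperbolic_at_Im0 (dhomog_toC hg) (stable_hyperbolic sg Ku) hz).
have D0 : lead_coef D != 0 by rewrite lead_coef_eq0 -size_poly_gt0 sD'.
have srs : size rs = d.+1.
  by move: sD'; rewrite DE size_scale // size_prod_XsubC => -[].
have hD s : 0 <= s -> D.[s] != 0.
  move=> s0; rewrite Dh; apply: ag.
  move: s0; rewrite le_eqVlt => /orP [/eqP <-|s0]; first by left; rewrite scale0r.
  by right; apply: open_cone_scale.
(* If [N(w) = i D(w)], the logarithmic derivative of [g] in direction [v] would be [i] at a point
   where Gauss-Lucas makes its imaginary part at most 0. *)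
have hE w : 0 < Im w -> (map_poly (real_complex R) N).[w]
    - I * (map_poly (real_complex R) D).[w] != 0.
  move=> hw; rewrite DC NC dird_toC.
  have E : cvec x + w *: cvec u = cvec (x + Re w *: u) + I *: cvec (Im w *: u).
    by rewrite cvecD -addrA -scale_cvec.
  rewrite !line_horner E.
  set b := _ + I *: _; pose f := line (toC g) b (cvec v).
  have hf z : 0 <= Im z -> f.[z] != 0.
    by apply: stable_half_plane => //; apply: open_cone_scale.
  have := Im_logderiv_le0 (w := 0) hf.
  rewrite deriv_line !line_meval0.
  apply: contraTneq => /eqP; rewrite subr_eq0 => /eqP ->.
  rewrite mulfK /= ?ltr01 -?ltNge //.
  by have := hf 0 (lexx _); rewrite line_meval0.
have := @partial_fractions R rs (lead_coef D) N D0; rewrite /= srs sN -DE.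
move=> /(_ isT hE) [l [NE lP]].
have := partial_fractions_convex NE lP hD t0.
rewrite /= D'h' N'h' !Dh !Nh -/p scale0r addr0 => hW; exact: hW.
Qed.

Lemma barrier_mono d g x u v : g \is d.+1.-homog -> stable g -> above g x ->
  u = 0 \/ K u -> v \in vs -> barrier v g (x + u) <= barrier v g x.
Proof.
move=> hg sg ag [->|Ku] vvs; first by rewrite addr0.
by have [] := barrier_convex hg sg ag Ku vvs ler01; rewrite scale1r.
Qed.

(** The new polynomial is [g] times [1 - y] times the barrier, and the barrier only decreases from
    [x] to [x + u]. *)
Lemma above_op d g c x v (y : R) :
  g \is d.+1.-homog -> stable g -> above g x -> v \in vs ->
  (forall u, u = 0 \/ K u -> c.@[(x + u) 0] = y) ->
  0 <= y -> y * barrier v g x < 1 -> above (g - c * dird v g) x.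
Proof.
move=> hg sg ag vvs hc y0 hy u hu; rewrite mevalB mevalM hc //.
have g0 := ag u hu.
have -> : g.@[(x + u) 0] - y * (dird v g).@[(x + u) 0] =
    g.@[(x + u) 0] * (1 - y * barrier v g (x + u)).
  by rewrite /barrier; field.
rewrite mulf_neq0 // gt_eqF // subr_gt0; apply: le_lt_trans hy.
by apply: ler_wpM2l => //; apply: (barrier_mono hg).
Qed.

(** At [x'] the operator subtracts from the barrier in direction [v'] its derivative along [v] times
    [y / (1 - y Phi)], with [Phi] the barrier in direction [v]. This factor is at most [del], and
    convexity shows that the move by [del] has already paid for the change. The term [eta e] puts
    the direction of motion inside [K]. *)
Lemma barrier_step d g c x v (y eta del : R) :
  g \is d.+1.-homog -> stable g -> above g x -> v \in vs ->
  (forall u, u = 0 \/ K u -> c.@[(x + u) 0] = y) ->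
  (forall v', v' \in vs -> dird v' c = 0) ->
  0 <= y -> 0 < eta -> 0 <= del -> y * barrier v g x < 1 ->
  y <= del * (1 - y * barrier v g x) ->
  let g' := g - c * dird v g in
  let x' := x + del *: (v + eta *: e) in
  above g' x' /\ forall v', v' \in vs -> barrier v' g' x' <= barrier v' g x.
Proof.
move=> hg sg ag vvs hc dc y0 eta0 del0 hy hdel g' x'.
have Ku0 : K (v + eta *: e).
  rewrite addrC -[v]scale1r; apply: open_cone_add_mem => //.
  exact: open_cone_dir.
have shift u : u = 0 \/ K u -> del *: (v + eta *: e) + u = 0 \/ K (del *: (v + eta *: e) + u).
  move: del0; rewrite le_eqVlt => /orP [/eqP <-|d0]; first by rewrite scale0r add0r.
  case=> [->|Ku]; right; first by rewrite addr0; apply: open_cone_scale.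
  rewrite scalerDr addrC addrA scalerA; apply: open_cone_add_dir.
    by apply: open_cone_add_mem => //; apply: ltW.
  by rewrite mulr_ge0 // ltW.
have bm : y * barrier v g x' <= y * barrier v g x.
  apply: ler_wpM2l => //; apply: (barrier_mono hg) => //.
  by have := shift 0 (or_introl erefl); rewrite addr0.
have y1 : y * barrier v g x' < 1 by apply: le_lt_trans hy.
have ag' u : u = 0 \/ K u -> g.@[(x' + u) 0] != 0.
  by move=> hu; rewrite /x' -addrA; apply: ag; apply: shift.
have cE u : u = 0 \/ K u -> c.@[(x' + u) 0] = y.
  by move=> hu; rewrite /x' -addrA; apply: hc; apply: shift.
split=> [|v' v'vs]; first exact: (above_op hg (y := y)).
have hb := barrier_convex hg sg ag Ku0 v'vs del0; case: hb.
rewrite -/x' !dird_lin !mevalD !mevalZ.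
have Ke : K e by have := open_cone_dir e vs (@ltr01 R); rewrite scale1r.
have ax' : above g x' by [].
(* A move of length 0 is enough to read off that the derivative along [e] is nonpositive. *)
have [We _ _] := barrier_convex hg sg ax' Ke v'vs (lexx 0).
move: We; rewrite scale0r addr0.
have g0 : g.@[x' 0] != 0 by have := ag' 0 (or_introl erefl); rewrite addr0.
have c0 : c.@[x' 0] = y by have := cE 0 (or_introl erefl); rewrite addr0.
have -> : barrier v' g' x' = ((dird v' g).@[x' 0] - y * (dird v (dird v' g)).@[x' 0])
     / (g.@[x' 0] - y * (dird v g).@[x' 0]).
  rewrite /barrier /g' dirdD dirdN dirdM dc // mul0r add0r dirdC.
  by rewrite !mevalB !mevalM c0.
move: g0 y1 bm; rewrite /barrier.
set G := g.@[x' 0]; set Gv := (dird v g).@[x' 0]; set Gv' := (dird v' g).@[x' 0].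
set Gvv := (dird v (dird v' g)).@[x' 0]; set Ge := (dird e g).@[x' 0].
set Gev := (dird e (dird v' g)).@[x' 0].
set P := (_ / _) in hdel hy *; set Q := _ / g.@[x 0].
move=> G0 y1 bm We Wu bq.
pose Wv := (Gvv * G - Gv' * Gv) / G ^+ 2.
pose We' := (Gev * G - Gv' * Ge) / G ^+ 2.
have -> : ((Gvv + eta * Gev) * G - Gv' * (Gv + eta * Ge)) / G ^+ 2 = Wv + eta * We'.
  by rewrite /Wv /We'; field.
move: We; rewrite -/We' => We hQ.
have den : 0 < 1 - y * (Gv / G) by rewrite subr_gt0.
have den' : G - y * Gv != 0.
  have -> : G - y * Gv = G * (1 - y * (Gv / G)) by field.
  by rewrite mulf_neq0 // gt_eqF.
have -> : (Gv' - y * Gvv) / (G - y * Gv) = Gv' / G - y / (1 - y * (Gv / G)) * Wv.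
  rewrite /Wv; field; rewrite G0 den' andbT //.
have yd : y / (1 - y * (Gv / G)) <= del.
  rewrite ler_pdivrMr //; apply: le_trans hdel _; apply: ler_wpM2l => //.
  by rewrite lerB.
have yd0 : 0 <= y / (1 - y * (Gv / G)) by rewrite divr_ge0 // ltW.
(* [v] need not lie in [K], so the sign of [Wv] is not known here; if it is nonnegative,
   monotonicity of the old barrier suffices. *)
have [Wv0|Wv0] := lerP 0 Wv.
  by apply: le_trans bq; rewrite gerBl mulr_ge0.
apply: le_trans hQ; rewrite lerB // mulrDr.
have h1 : del * Wv <= y / (1 - y * (Gv / G)) * Wv by rewrite ler_wnM2r // ltW.
have h2 : del * (eta * We') <= 0 by rewrite mulr_ge0_le0 // mulr_ge0_le0 // ltW.
by lra.
Qed.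

End Stable.

(** * The mixed polynomial *)

Section Spectrum.
Variables (R : rcfType) (n : nat).
Notation C := (R[i]).
Notation toC := (map_mpoly (real_complex R)).
Notation I := ((0 +i* 1)%C : C).
Notation row f := (\row_i f i).
Implicit Types (h : {mpoly R[n]}) (e x : 'I_n -> R).

Lemma poly_ext_neq0 (p q : {poly R}) : (forall s, s != 0 -> p.[s] = q.[s]) -> p = q.
Proof.
move=> hpq; apply/eqP; rewrite -subr_eq0; apply/eqP.
apply: (roots_geq_poly_eq0 (rs := [seq k.+1%:R | k <- iota 0 (size (p - q))])).
- apply/allP => _ /mapP [k _ ->]; rewrite rootE hornerD hornerN hpq ?subrr //.
  by rewrite pnatr_eq0.
- rewrite map_inj_uniq ?iota_uniq // => i j /eqP; rewrite eqr_nat eqSS.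
  by move=> /eqP.
- by rewrite size_map size_iota.
Qed.

Lemma meval_row h e : h.@[(row e) 0] = h.@[e].
Proof. by apply: meval_eq => i; rewrite mxE. Qed.

Lemma restr_polyE h e x : restr_poly h e x = line h (- row x) (row e).
Proof.
rewrite /restr_poly /line /mmap; apply: eq_bigr => k _; congr (_ * _).
by apply: mmap1_eq => i; rewrite !mxE polyCN mul_polyC addrC.
Qed.

Lemma hyperbolic_toC d h e : hyperbolic d h e -> hyperbolic_at (toC h) (row e).
Proof.
move=> [_ _ hr] x a a0; apply/negP => /eqP h0.
have := hr (fun i => - x 0 i) (0 +i* a)%C.
rewrite restr_polyE; have -> : - (\row_i - x 0 i) = x.
  by apply/rowP => i; rewrite !mxE opprK.
rewrite line_toC rootE line_horner scale_cvec /= scale0r cvec0 add0r h0 eqxx.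
by move=> /(_ isT) a1; rewrite a1 ltxx in a0.
Qed.

(** [in_Lambda_plus] and [trace_le] quantify over all eigenvalue lists, so a list is needed before
    they yield anything. *)
Lemma eigenvalues_exist d h e x : hyperbolic d h e -> exists s, eigenvalues d h e x s.
Proof.
move=> [hd he hr]; have [z z0|rs DE] := @real_rooted_split R (restr_poly h e x).
  by apply: (hr x z); rewrite rootE z0.
have [sD lD] := dhomog_line (- row x) (row e) hd.
rewrite -restr_polyE meval_row in sD lD.
have sD' : size (restr_poly h e x) = d.+1.
  apply/eqP; rewrite eqn_leq sD /=; apply: contraT; rewrite -leqNgt => s1.
  by move: he; rewrite -lD nth_default ?eqxx.
have lE : lead_coef (restr_poly h e x) = h.@[e] by rewrite lead_coefE sD'.
exists rs; split; last by rewrite {1}DE lE.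
by move: sD'; rewrite DE lE size_scale // size_prod_XsubC => -[].
Qed.

(** The point is [- b] times the point [t e - x] with [t = - a / b]; homogeneity then distributes
    one factor [- b] to each eigenvalue. *)
Lemma meval_eigenvalues d h e x s (a b : R) : h \is d.-homog ->
  eigenvalues d h e x s -> b != 0 ->
  h.@[(a *: row e + b *: row x) 0] = h.@[e] * \prod_(l <- s) (a + b * l).
Proof.
move=> hd [ss sE] b0.
have -> : a *: row e + b *: row x = (- b) *: (- row x + (- (a / b)) *: row e).
  rewrite scalerDr scalerN scaleNr opprK addrC; congr (_ + _).
  by rewrite scalerA mulrNN mulrC divfK.
rewrite (dhomog_meval _ _ hd) -line_horner -restr_polyE sE hornerZ mulrCA; congr (_ * _).
rewrite -ss horner_prod; elim: s {ss sE} => [|l s IH]; first by rewrite !big_nil mulr1.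
rewrite !big_cons /= exprS hornerXsubC mulrACA IH; congr (_ * _).
by field.
Qed.

Lemma line_eigenvalues d h e x s (a : R) : h \is d.-homog ->
  eigenvalues d h e x s ->
  line h (a *: row e) (row x) = h.@[e] *: \prod_(l <- s) (a%:P + l%:P * 'X).
Proof.
move=> hd hs; apply: poly_ext_neq0 => b b0.
rewrite line_horner (meval_eigenvalues _ hd hs b0) hornerZ horner_prod; congr (_ * _).
by apply: eq_bigr => l _; rewrite hornerD hornerC hornerCM hornerX mulrC.
Qed.

(** Logarithmic derivative at 0 of the product of the [a + l s]. Here the traces become bounds on
    the initial barriers. *)
Lemma barrier_eigenvalues d h e x s (a : R) : h \is d.-homog -> h.@[e] != 0 ->
  eigenvalues d h e x s -> 0 < a ->
  barrier (row x) h (a *: row e) = (\sum_(l <- s) l) / a.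
Proof.
move=> hd he hs a0; rewrite /barrier -2!(line_meval0 _ (a *: row e) (row x)) -deriv_line.
rewrite (line_eigenvalues a hd hs) derivZ !hornerZ -mulf_div divff // mul1r.
set P := \prod_(l <- s) _.
suff [-> P0] : P^`().[0] = (\sum_(l <- s) l) / a * P.[0] /\ P.[0] != 0 by rewrite mulfK.
rewrite /P; elim: s {hs P} => [|l s [IH1 IH2]].
  by rewrite !big_nil derivC hornerC !mul0r hornerC oner_eq0.
have l0 : (a%:P + l%:P * 'X).[0] = a by rewrite hornerD hornerC hornerCM hornerX mulr0 addr0.
have l1 : (a%:P + l%:P * 'X)^`().[0] = l.
  by rewrite derivD derivC add0r derivM derivC mul0r add0r derivX mulr1 hornerC.
rewrite !big_cons derivM hornerD !hornerM IH1 l0 l1; split; last by rewrite mulf_neq0 // gt_eqF.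
by field; rewrite gt_eqF.
Qed.

Lemma euler d h (x : 'rV[R]_n) : h \is d.-homog -> (dird x h).@[x 0] = d%:R * h.@[x 0].
Proof.
move=> hd; have E : line h x x = h.@[x 0] *: (1 + 'X) ^+ d.
  apply: poly_ext_neq0 => s _; rewrite line_horner hornerZ horner_exp hornerD hornerC hornerX.
  by rewrite -{1}[x]scale1r -scalerDl (dhomog_meval _ _ hd) mulrC.
rewrite -(line_meval0 _ x x) -deriv_line E derivZ hornerZ deriv_exp derivD derivX derivC.
by rewrite add0r mul1r hornerMn horner_exp hornerD hornerC hornerX addr0 expr1n mulrC.
Qed.

Lemma in_Lambda_plus_meval d h e x (a : R) : hyperbolic d h e ->
  in_Lambda_plus d h e x -> 0 < a -> h.@[(row x + a *: row e) 0] != 0.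
Proof.
move=> hh hx a0; have [s hs] := eigenvalues_exist x hh; case: hh => hd he _.
have := meval_eigenvalues a hd hs (oner_neq0 R); rewrite scale1r addrC => ->.
rewrite mulf_neq0 // prodf_seq_neq0; apply/allP => l ls /=.
by rewrite mul1r gt_eqF // ltr_wpDr // (hx _ hs).
Qed.

End Spectrum.

(** * The commuting operators that build the mixed polynomial *)

Section MixedOps.
Variables (R : rcfType) (n m : nat).
Notation C := (R[i]).
Notation "x %:C" := (real_complex R x).
Notation toC := (map_mpoly (real_complex R)).
Notation I := ((0 +i* 1)%C : C).
Implicit Types (h : {mpoly R[n]}) (p g : {mpoly R[n + m]}) (X U : 'rV[R]_(n + m)).

Definition xdir (f : 'I_n -> R) : 'rV[R]_(n + m) := row_mx (\row_i f i) 0.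

Lemma xdir_y0 f j : xdir f 0 (rshift n j) = 0.
Proof. by rewrite row_mxEr mxE. Qed.

Lemma Dx_dird f p : Dx f p = dird (xdir f) p.
Proof.
rewrite /dird big_split_ord /= [X in _ + X]big1 ?addr0 => [|j _].
  by apply: eq_bigr => i _; rewrite row_mxEl mxE.
by rewrite row_mxEr mxE scale0r.
Qed.

Lemma lift_x_meval h X : (lift_x m h).@[X 0] = h.@[(lsubmx X) 0].
Proof.
apply: (mmap_comp (phi := meval (X 0))) => [c|i] /=; first by rewrite mevalC.
by rewrite mevalXU mxE.
Qed.

Lemma lift_x_toC_meval h (Z : 'rV[C]_(n + m)) :
  (toC (lift_x m h)).@[Z 0] = (toC h).@[(lsubmx Z) 0].
Proof.
pose k i := (lsubmx Z) 0 i.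
transitivity (mmap (real_complex R) k h).
  apply: (mmap_comp (phi := meval (Z 0) \o toC)) => [c|i] /=.
    by rewrite map_mpolyC mevalC.
  by rewrite map_mpolyX mevalXU /k mxE.
apply/esym; apply: (mmap_comp (phi := meval ((lsubmx Z) 0))) => [c|i] /=.
  by rewrite mevalC.
by rewrite mevalXU.
Qed.

Lemma lift_x_homog d h : h \is d.-homog -> lift_x m h \is d.-homog.
Proof.
move=> /dhomogP hd; rewrite /lift_x /mmap big_seq; apply: rpred_sum => k /hd kd.
rewrite mul_mpolyC rpredZ // -kd /= mdegE /mmap1.
elim/big_rec2: _ => [|i a b _ IH]; first exact: dhomog1.
apply: dhomogM => //; have := @dhomogMn (n + m) R mdeg 1%N 'X_(lshift m i) (k i).
by rewrite mul1n; apply; rewrite dhomogX /= mdeg1.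
Qed.

Lemma line_lift_x h X (f : 'I_n -> R) :
  line (lift_x m h) X (xdir f) = line h (lsubmx X) (\row_i f i).
Proof.
apply: poly_ext_neq0 => s _; rewrite !line_horner lift_x_meval.
congr (_.@[_ 0]); rewrite /xdir -{1}[X]hsubmxK scale_row_mx add_row_mx row_mxKl //.
Qed.

Lemma barrier_lift_x h X (f : 'I_n -> R) :
  barrier (xdir f) (lift_x m h) X = barrier (\row_i f i) h (lsubmx X).
Proof.
rewrite /barrier lift_x_meval -(line_meval0 _ X (xdir f)) -deriv_line line_lift_x.
by rewrite deriv_line line_meval0.
Qed.

Variables (e : 'I_n -> R) (v : 'I_m -> 'I_n -> R).

Definition vdirs := [seq xdir (v j) | j <- enum 'I_m].

Notation K := (open_cone (xdir e) vdirs).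

Definition mixed_op j p := p - 'X_(rshift n j) * dird (xdir (v j)) p.

Lemma mixedE h : mixed h v = foldr mixed_op (lift_x m h) (enum 'I_m).
Proof. by rewrite /mixed; elim: (enum _) => //= j s ->; rewrite Dx_dird. Qed.

Lemma dird_xdir_y (f : 'I_n -> R) j : dird (xdir f) ('X_(rshift n j) : {mpoly R[n + m]}) = 0.
Proof.
rewrite -Dx_dird /Dx big1 // => i _.
by rewrite mderivX mnm1E eq_sym eq_lrshift scale0r scaler0.
Qed.

Lemma mixed_opC i j p : mixed_op i (mixed_op j p) = mixed_op j (mixed_op i p).
Proof.
rewrite /mixed_op !dirdD !dirdN !dirdM !dird_xdir_y !mul0r !add0r.
by rewrite (dirdC (xdir (v j))); ring.
Qed.

(** By commutation any chosen [j] can be applied last, where it may carry the larger weight. *)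
Lemma foldr_mixed_op_rem j l p : j \in l ->
  foldr mixed_op p l = mixed_op j (foldr mixed_op p (rem j l)).
Proof.
elim: l => // i l IH; rewrite inE [rem _ _]/= eq_sym; case: eqVneq => [->//|ij] jl.
by rewrite -[LHS]/(mixed_op i (foldr mixed_op p l)) (IH jl); exact: mixed_opC.
Qed.

Lemma mixed_op_homog d j p : p \is d.+1.-homog -> mixed_op j p \is d.+1.-homog.
Proof.
move=> hp; rewrite rpredB // -add1n; apply: dhomogM; last exact: (dhomog_dird _ hp).
by rewrite dhomogX /= mdeg1.
Qed.

Lemma mem_vdirs j : xdir (v j) \in vdirs.
Proof. by apply: map_f; rewrite mem_enum. Qed.

(** All generators have zero [y]-part. Hence each [y]-variable is constant along shifts by the cone
    and real at [x + i u], as the operator lemmas require. *)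
Lemma open_cone_y0 U j : K U -> U 0 (rshift n j) = 0.
Proof.
rewrite /vdirs; elim: (enum _) U => [|i s IH] U /=.
  by case=> a _ ->; rewrite mxE xdir_y0 mulr0.
by case=> b _ /IH; rewrite mxE [X in _ + X]mxE [X in - X]mxE xdir_y0 mulr0 subr0.
Qed.

Lemma mixed_op_stable j p : stable (xdir e) vdirs p -> stable (xdir e) vdirs (mixed_op j p).
Proof.
move=> sp; apply: stable_op => //; first exact: mem_vdirs.
move=> X U KU; rewrite map_mpolyX !mevalXU !mxE (open_cone_y0 _ KU).
by rewrite rmorph0 mulr0 addr0.
Qed.

Lemma y_meval X U j : U = 0 \/ K U ->
  ('X_(rshift n j) : {mpoly R[n + m]}).@[(X + U) 0] = X 0 (rshift n j).
Proof.
by rewrite mevalXU mxE => -[->|/open_cone_y0 ->]; rewrite ?mxE addr0.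
Qed.

(** Each operator is one [barrier_step]: the common bound [phi] is preserved, and the moves leave
    the [y]-coordinates at [q], so the same inequality serves at every step. *)
Lemma foldr_mixed_op_barrier d g l X (phi q eta del : R) :
  g \is d.+1.-homog -> stable (xdir e) vdirs g -> above (xdir e) vdirs g X ->
  (forall j, barrier (xdir (v j)) g X <= phi) ->
  (forall j, j \in l -> X 0 (rshift n j) = q) ->
  0 <= q -> 0 < eta -> 0 <= del -> q * phi < 1 -> q <= del * (1 - q * phi) ->
  let g' := foldr mixed_op g l in
  let X' := X + \sum_(j <- l) del *: (xdir (v j) + eta *: xdir e) in
  [/\ g' \is d.+1.-homog, stable (xdir e) vdirs g', above (xdir e) vdirs g' X'
    & forall j, barrier (xdir (v j)) g' X' <= phi].
Proof.
move=> hg sg ag bg + q0 eta0 del0 hq hdel.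
elim: l => [|j l IH] hl /=; first by rewrite big_nil addr0.
have [|h1 h2 h3 h4] := IH; first by move=> i il; apply: hl; rewrite inE il orbT.
set g1 := foldr _ _ _ in h1 h2 h3 h4 *; set X1 := X + _ in h3 h4.
have X1j : X1 0 (rshift n j) = q.
  rewrite mxE hl ?mem_head // summxE big1 ?addr0 // => i _.
  by rewrite mxE [X in _ * X]mxE [X in _ + X]mxE !xdir_y0 mulr0 addr0 mulr0.
have qb : q * barrier (xdir (v j)) g1 X1 <= q * phi by apply: ler_wpM2l.
have hc U : U = 0 \/ K U ->
    ('X_(rshift n j) : {mpoly R[n + m]}).@[(X1 + U) 0] = q.
  by move=> KU; rewrite y_meval.
have dc w : w \in vdirs -> dird w ('X_(rshift n j) : {mpoly R[n + m]}) = 0.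
  by move=> /mapP [i _ ->]; apply: dird_xdir_y.
have hy : q * barrier (xdir (v j)) g1 X1 < 1 by apply: le_lt_trans hq.
have hyd : q <= del * (1 - q * barrier (xdir (v j)) g1 X1).
  by apply: le_trans hdel _; apply: ler_wpM2l => //; rewrite lerB.
have [h5 h6] := barrier_step h1 h2 h3 (mem_vdirs j) hc dc q0 eta0 del0 hy hyd.
have -> : X + \sum_(i <- j :: l) del *: (xdir (v i) + eta *: xdir e) =
   X1 + del *: (xdir (v j) + eta *: xdir e) by rewrite big_cons addrCA addrC.
split; [exact: mixed_op_homog | exact: mixed_op_stable | exact: h5 |].
by move=> i; apply: le_trans (h6 _ (mem_vdirs i)) (h4 i).
Qed.

End MixedOps.

(** * Points above the zeros of the mixed polynomial *)

Section MixedBound.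
Variables (R : rcfType) (n m : nat).
Notation C := (R[i]).
Notation toC := (map_mpoly (real_complex R)).
Notation I := ((0 +i* 1)%C : C).
Implicit Types (h : {mpoly R[n]}) (X U : 'rV[R]_(n + m)).

Lemma lsub_xdir (f : 'I_n -> R) : lsubmx (xdir m f) = \row_i f i.
Proof. exact: row_mxKl. Qed.

Lemma lift_x_stable d h (e : 'I_n -> R) (v : 'I_m -> 'I_n -> R) :
  hyperbolic d h e -> (forall j, in_Lambda_plus d h e (v j)) ->
  stable (xdir m e) (vdirs v) (lift_x m h).
Proof.
move=> hh hv; have [hd _ _] := hh.
apply: (nonvanishing_open_cone (dhomog_toC (lift_x_homog m hd))).
  move=> X a a0; rewrite lift_x_toC_meval.
  have -> : lsubmx (cvec X + I *: cvec (a *: xdir m e)) =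
      cvec (lsubmx X) + I *: cvec (a *: (\row_i e i)).
    by rewrite -lsub_xdir; apply/rowP => i; rewrite !mxE.
  exact: (hyperbolic_toC hh).
move=> _ s /mapP [j _ ->] s0; rewrite meval_toC lift_x_meval.
have -> : lsubmx (xdir m (v j) + s *: xdir m e) = (\row_i v j i) + s *: (\row_i e i).
  by rewrite -!lsub_xdir; apply/rowP => i; rewrite !mxE.
have := in_Lambda_plus_meval hh (hv j) s0.
by apply: contra_neq => /complexI.
Qed.

Lemma mixed_stable d h (e : 'I_n -> R) (v : 'I_m -> 'I_n -> R) :
  hyperbolic d.+1 h e -> (forall j, in_Lambda_plus d.+1 h e (v j)) ->
  mixed h v \is d.+1.-homog /\ stable (xdir m e) (vdirs v) (mixed h v).
Proof.
move=> hh hv; have [hd _ _] := hh; rewrite mixedE; elim: (enum _) => [|j l [IH1 IH2]] /=.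
  by split; [exact: lift_x_homog | exact: lift_x_stable hv].
by split; [exact: mixed_op_homog | exact: mixed_op_stable].
Qed.

(** At [alpha e] the trace bound makes all barriers at most [eps / alpha]. The operators other than
    [j] are applied with weight [q] and a move each; [j] comes last with weight [kappa], where
    [above_op] needs no move. *)
Lemma above_mixed d h (e : 'I_n -> R) (v : 'I_m -> 'I_n -> R) eps j
    (alpha kappa q eta del : R) :
  hyperbolic d.+1 h e -> (forall i, in_Lambda_plus d.+1 h e (v i)) ->
  (forall i, trace_le d.+1 h e (v i) eps) ->
  0 < alpha -> 0 <= kappa -> 0 <= q -> 0 < eta -> 0 <= del ->
  kappa * (eps / alpha) < 1 -> q * (eps / alpha) < 1 ->
  q <= del * (1 - q * (eps / alpha)) ->
  above (xdir m e) (vdirs v) (mixed h v)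
    (row_mx (alpha *: \row_i e i) (\row_k if k == j then kappa else q)
      + \sum_(i <- rem j (enum 'I_m)) del *: (xdir m (v i) + eta *: xdir m e)).
Proof.
move=> hh hv ht a0 k0 q0 eta0 del0 hk hq hdel; have [hd he _] := hh.
set X0 := row_mx _ _.
have lX0 : lsubmx X0 = alpha *: (\row_i e i) by exact: row_mxKl.
have hs := lift_x_stable hh hv; have hH := lift_x_homog m hd.
have aX0 : above (xdir m e) (vdirs v) (lift_x m h) X0.
  move=> U KU; have := stable_dir (u := U + alpha *: xdir m e) hH hs.
  rewrite !lift_x_meval.
  have -> : lsubmx (U + alpha *: xdir m e) = lsubmx (X0 + U).
    have E Y Z : lsubmx (Y + Z) = lsubmx Y + lsubmx Z :> 'rV[R]_n.
      by apply/rowP => i; rewrite !mxE.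
    rewrite !E lX0 addrC -lsub_xdir; congr (_ + _).
    by apply/rowP => i; rewrite !mxE.
  apply; case: KU => [->|KU]; first by rewrite add0r; apply: open_cone_dir.
  by apply: open_cone_add_dir => //; apply: ltW.
have bX0 i : barrier (xdir m (v i)) (lift_x m h) X0 <= eps / alpha.
  rewrite barrier_lift_x lX0; have [s sE] := eigenvalues_exist (v i) hh.
  rewrite (barrier_eigenvalues hd he sE a0); apply: ler_wpM2r; last exact: ht sE.
  by rewrite invr_ge0 ltW.
have uen := enum_uniq 'I_m.
have yX0 i : i \in rem j (enum 'I_m) -> X0 0 (rshift n i) = q.
  rewrite mem_rem_uniq // inE => /andP[ij _].
  by rewrite row_mxEr mxE (negPf ij).
have [h1 h2 h3 h4] := foldr_mixed_op_barrier hH hs aX0 bX0 yX0 q0 eta0 del0 hq hdel.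
rewrite mixedE (foldr_mixed_op_rem v (lift_x m h) (j := j)) ?mem_enum //.
apply: (above_op h1 h2 h3 (mem_vdirs v j) (y := kappa)) => //.
  move=> U KU; rewrite (y_meval _ _ KU) mxE row_mxEr mxE eqxx summxE big1 ?addr0 // => i _.
  by rewrite mxE [X in _ * X]mxE [X in _ + X]mxE !xdir_y0 mulr0 addr0 mulr0.
by apply: le_lt_trans hk; apply: ler_wpM2l.
Qed.

Lemma open_cone_sum (k : nat) (E u : 'rV[R]_k) (T : eqType) (l : seq T)
    (w : T -> 'rV[R]_k) ws (b : R) :
  0 <= b -> open_cone E ws u -> (forall i, i \in l -> w i \in ws) ->
  open_cone E ws (u + \sum_(i <- l) b *: w i).
Proof.
move=> b0 Ku; elim: l => [|i l IH] hl; first by rewrite big_nil addr0.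
rewrite big_cons addrCA addrC; apply: open_cone_add_mem => //.
  by apply: IH => k' kl; apply: hl; rewrite inE kl orbT.
by apply: hl; rewrite mem_head.
Qed.

Lemma eval_te1_horner (P : {mpoly R[n + m]}) (e : 'I_n -> R) t :
  (eval_te1 P e).[t] = P.@[(t *: xdir m e + row_mx 0 (const_mx 1)) 0].
Proof.
apply: (mmap_comp (phi := horner_eval t)) => [c|k] /=; first by rewrite /horner_eval hornerC.
rewrite /horner_eval !mxE; case: (split k) => j; rewrite !mxE.
  by rewrite hornerZ hornerX mulrC addr0.
by rewrite hornerC mulr0 add0r.
Qed.

(** At [e] the barriers are the traces, and they add up to the logarithmic derivative in direction
    [e], which is the degree by Euler's identity. The degree is at least 1. *)
Lemma trace_lower_bound d h (e : 'I_n -> R) (v : 'I_m -> 'I_n -> R) eps :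
  (0 < m)%N -> hyperbolic d.+1 h e -> (forall i, e i = \sum_(j < m) v j i) ->
  (forall j, trace_le d.+1 h e (v j) eps) -> m%:R^-1 <= eps.
Proof.
move=> m0 hh hE ht; have [hd he _] := hh.
have b1 j : barrier (\row_i v j i) h (\row_i e i) <= eps.
  have [s sE] := eigenvalues_exist (v j) hh.
  have := barrier_eigenvalues hd he sE ltr01; rewrite scale1r divr1 => ->.
  exact: ht sE.
have : \sum_(j < m) barrier (\row_i v j i) h (\row_i e i) = d.+1%:R.
  have -> : \sum_(j < m) barrier (\row_i v j i) h (\row_i e i)
      = (dird (\row_i e i) h).@[(\row_i e i) 0] / h.@[(\row_i e i) 0].
    have -> : (\row_i e i) = \sum_(j < m) (\row_i v j i) :> 'rV[R]_n.
      by apply/rowP => i; rewrite mxE hE summxE; apply: eq_bigr => j _; rewrite mxE.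
    by rewrite dird_sum raddf_sum mulr_suml.
  by rewrite (euler _ hd) mulfK // meval_row.
have : \sum_(j < m) barrier (\row_i v j i) h (\row_i e i) <= \sum_(j < m) eps.
  exact: ler_sum.
rewrite sumr_const card_ord => + E; rewrite E => hle.
have m0' : 0 < m%:R :> R by rewrite ltr0n.
rewrite -[X in X <= _]mulr1 mulrC ler_pdivrMr //; rewrite -[X in _ <= X]mulr_natr in hle.
by apply: le_trans hle; rewrite ler1n.
Qed.

End MixedBound.

(** * Choice of parameters and the final bound *)

(* [q <= del * (1 - q / kappa)] is the cost of a barrier step of weight [q] when the
   barriers are at most [1 / kappa].  The value of [kappa] minimises the final bound. *)
Lemma barrier_parameters (R : rcfType) (m : nat) (eps : R) :
  (0 < m)%N -> m%:R^-1 <= eps ->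
  exists kappa q del : R,
    [/\ 0 < kappa, 0 <= q <= kappa, 0 <= del & q * kappa <= del * (kappa - q)] /\
    m%:R^-1 * kappa + (1 - m%:R^-1) * q = 1 /\
    kappa * eps + del * (1 - m%:R^-1) = Defs.delta eps m.
Proof.
move=> m0 heps; rewrite /Defs.delta; set b := m%:R^-1 in heps *.
have b0 : 0 < b by rewrite invr_gt0 ltr0n.
have b1 : b <= 1 by rewrite invf_le1 ?ltr0n // ler1n.
set S := Num.sqrt _.
(* The lower bound on [eps] gives [b <= S], which keeps both [q] and [del] nonnegative. *)
have bb : b ^+ 2 <= eps - b * (1 - b) by nra.
have S2 : S ^+ 2 = eps - b * (1 - b) by rewrite sqr_sqrtr // (le_trans (sqr_ge0 b)).
have bS : b <= S.
  rewrite -[b]gtr0_norm // -sqrtr_sqr; apply: ler_wsqrtr; exact: bb.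
have S0 : 0 < S by apply: lt_le_trans bS.
have Sn : S != 0 by rewrite gt_eqF.
have eE : eps = S ^+ 2 + b * (1 - b) by rewrite S2 subrK.
(* The averaging equation forces [q] once [kappa] is chosen; then [kappa - q = S^-1], and [del] is
   [q kappa / (kappa - q)]. *)
exists (1 + (1 - b) / S), (1 - b / S), ((S - b) * (S + (1 - b)) / S).
have aS : 0 <= (1 - b) / S by rewrite divr_ge0 ?subr_ge0 // ltW.
have bS1 : b / S <= 1 by rewrite ler_pdivrMr // mul1r.
have bS0 : 0 <= b / S by rewrite divr_ge0 // ltW.
split; [split | split].
- by lra.
- by apply/andP; split; lra.
- by apply: divr_ge0; [apply: mulr_ge0; lra | exact: ltW].
- rewrite le_eqVlt; apply/orP; left; apply/eqP; field.
  exact: Sn.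
- by field.
- rewrite {1}eE; field.
  exact: Sn.
Qed.

Theorem theorem4p5 (R : rcfType) (n m d : nat) (h : {mpoly R[n]})
    (e : 'I_n -> R) (v : 'I_m -> 'I_n -> R) (eps : R) :
  (0 < m)%N ->
  hyperbolic d h e ->
  (forall j, in_Lambda_plus d h e (v j)) ->
  (forall i, e i = \sum_(j < m) v j i) ->
  (forall j, trace_le d h e (v j) eps) ->
  forall t : R, root (eval_te1 (mixed h v) e) t -> t <= delta eps m.
Proof.
move=> m0 hh hv hE ht t; rewrite rootE eval_te1_horner => /eqP Pt.
(* In degree 0 the mixed polynomial is the nonzero constant [h], so it has no zero; the barrier
   lemmas require positive degree. *)
case: d hh hv ht => [|d] hh hv ht.
  exfalso; have [/dhomogP hd he _] := hh.
  have hC : h = (h@_0)%:MP.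
    apply/mpolyP => k; rewrite mcoeffC eq_sym; case: eqVneq => [->|k0]; rewrite ?mulr1 // mulr0.
    apply: memN_msupp_eq0; apply/negP => /hd /eqP; rewrite /= mdeg_eq0 => /eqP kE.
    by rewrite kE eqxx in k0.
  have PC : mixed h v = (h@_0)%:MP.
    rewrite mixedE; elim: (enum _) => [|j l IH] /=.
      by rewrite hC /lift_x mmapC mcoeffC eqxx mulr1.
    rewrite IH /mixed_op /dird big1 ?mulr0 ?subr0 // => i _.
    by rewrite mderivC scaler0.
  by move: he; rewrite hC mevalC; move: Pt; rewrite PC mevalC => ->; rewrite eqxx.
have heps := trace_lower_bound m0 hh hE ht.
have [kappa [q [del [[k0 /andP[q0 qk] del0 hqk] [hy hT]]]]] := barrier_parameters m0 heps.
rewrite leNgt; apply/negP => tT.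
have mR0 : 0 < m%:R :> R by rewrite ltr0n.
have mRn : m%:R != 0 :> R by rewrite gt_eqF.
have eps0 : 0 < eps by apply: lt_le_trans heps; rewrite invr_gt0.
(* One third of the gap makes [kappa * phi < 1] strict, one third pays for the [eta] terms, and the
   last keeps [rho] positive. *)
pose r := (t - delta eps m) / 3.
have r0 : 0 < r by rewrite /r; lra.
pose alpha := kappa * eps + r.
have al0 : 0 < alpha by rewrite addr_gt0 // mulr_gt0.
pose phi := eps / alpha.
have phi0 : 0 <= phi by rewrite divr_ge0 // ltW.
have kphi : kappa * phi < 1 by rewrite /phi mulrA ltr_pdivrMr // mul1r /alpha; lra.
have qphi : q * phi < 1 by apply: le_lt_trans kphi; apply: ler_wpM2r.
have hdel : q <= del * (1 - q * phi).
  rewrite -(ler_pM2r k0); apply: le_trans hqk _; rewrite -mulrA; apply: ler_wpM2l => //.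
  rewrite mulrBl mul1r lerB // -mulrA [phi * _]mulrC ler_piMr //.
  exact: ltW.
(* Small enough that the perturbations cost at most [r] in total; the [+ 1] covers [del = 0]. *)
pose eta := r / (del * m%:R + 1).
have dm : 0 < del * m%:R + 1 by rewrite ltr_wpDl // mulr_ge0 // ltW.
have eta0 : 0 < eta by rewrite divr_gt0.
have hde : del * (m%:R * eta) <= r.
  by rewrite /eta mulrA mulrA ler_pdivrMr //; nra.
pose E := xdir m e; pose V j := xdir m (v j).
pose Y j : 'rV[R]_(n + m) := row_mx 0 (\row_k if k == j then kappa else q).
pose W j := row_mx (alpha *: \row_i e i) (\row_k if k == j then kappa else q)
      + \sum_(i <- rem j (enum 'I_m)) del *: (V i + eta *: E).
have [hP sP] := mixed_stable hh hv.
have hW j : above E (vdirs v) (mixed h v) (W j).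
  exact: (above_mixed j hh hv ht al0 (ltW k0) q0 eta0 del0 kphi qphi hdel).
pose ws := [seq W j | j <- enum 'I_m].
(* The cone theorem is used again, now for the mixed polynomial with the points [W j] as generators.
   This is what allows them to be averaged. *)
have sW : stable E ws (mixed h v).
  apply: (nonvanishing_open_cone (dhomog_toC hP)).
    by apply: (stable_hyperbolic sP); have := open_cone_dir E (vdirs v) (@ltr01 R); rewrite scale1r.
  move=> _ s /mapP [j _ ->] s0; rewrite meval_toC.
  have := hW j (s *: E) (or_intror (open_cone_dir E (vdirs v) s0)).
  by apply: contra_neq => /complexI.
(* What remains of [t] after subtracting the coefficient of [E] in the average of the [W j]. *)
pose rho := t - alpha - del * (1 - m%:R^-1 + (m%:R - 1) * eta).
have rho0 : 0 < rho.
  have h1 : del * ((m%:R - 1) * eta) <= r.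
    apply: le_trans hde; apply: ler_wpM2l => //; apply: ler_wpM2r; first exact: ltW.
    by rewrite gerBl.
  have tE : t = delta eps m + 3 * r by rewrite /r; field.
  rewrite /rho /alpha tE -hT; rewrite mulrDr; lra.
have : open_cone E ws (rho *: E + \sum_(j <- enum 'I_m) m%:R^-1 *: W j).
  apply: open_cone_sum; [by rewrite invr_ge0 ltW | exact: open_cone_dir |].
  by move=> j _; apply: map_f; rewrite mem_enum.
have EV : \sum_(j < m) V j = E.
  apply/rowP => k; rewrite summxE; case: (split_ordP k) => i ->.
    by rewrite row_mxEl mxE hE; apply: eq_bigr => j _; rewrite row_mxEl mxE.
  by rewrite xdir_y0 big1 // => j _; rewrite xdir_y0.
(* The sum over [i != j] is the full sum minus its [j]-th term, and the full sum is known because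
   the [V i] add up to [E]. *)
have WE j : W j = alpha *: E + Y j + del *: ((1 + m%:R * eta) *: E - (V j + eta *: E)).
  rewrite /W; congr (_ + _).
    by rewrite /E /Y /xdir scale_row_mx scaler0 add_row_mx addr0 add0r.
  rewrite -scaler_sumr; congr (_ *: _).
  have : \sum_(i <- enum 'I_m) (V i + eta *: E) = (1 + m%:R * eta) *: E.
    rewrite big_enum big_split /= EV sumr_const card_ord -scaler_nat scalerA scalerDl.
    by rewrite scale1r.
  rewrite (perm_big _ (perm_to_rem (mem_enum 'I_m j))) big_cons /= => <-.
  by rewrite [X in _ = X - _]addrC addrK.
have YE : \sum_(j < m) m%:R^-1 *: Y j = row_mx 0 (const_mx 1).
  apply/rowP => k; rewrite summxE; case: (split_ordP k) => i ->.
    by rewrite row_mxEl mxE big1 // => j _; rewrite mxE /Y row_mxEl mxE mulr0.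
  rewrite row_mxEr mxE (bigD1 i) //= [X in X + _]mxE /Y row_mxEr mxE eqxx -/Y.
  have -> : \sum_(j < m | j != i) (m%:R^-1 *: Y j) 0 (rshift n i) =
      \sum_(j < m | j != i) m%:R^-1 * q.
    by apply: eq_bigr => j ji; rewrite mxE row_mxEr mxE eq_sym (negPf ji).
  rewrite sumr_const cardC1 card_ord -[RHS]hy; congr (_ + _).
  rewrite -[LHS]mulr_natr -subn1 natrB //; field.
  exact: mRn.
(* The point at which the mixed polynomial was assumed to vanish thus lies in the new cone, where
   [stable_dir] forbids zeros. *)
have -> : rho *: E + \sum_(j <- enum 'I_m) m%:R^-1 *: W j = t *: E + row_mx 0 (const_mx 1).
  rewrite big_enum /=.
  under eq_bigr => j _ do rewrite WE !scalerDr.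
  rewrite !big_split /= YE -!scaler_sumr.
  rewrite sumrN big_split /= EV !sumr_const card_ord -!scaler_nat -[X in - (X + _)]scale1r.
  rewrite !scalerA -scalerDl -scaleNr !scalerA -scalerDl [_ + row_mx _ _ + _]addrAC.
  rewrite -scalerDl addrA -scalerDl; congr (_ *: _ + _).
  rewrite /rho; field.
  exact: mRn.
by move=> /(stable_dir hP sW); rewrite Pt eqxx.
Qed.
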